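(* Let $M$ be an odd-dimensional smooth manifold. Every generalized almost contact structure $(E,L)$ on $M$ is represented by an element of $\mathrm{Sek}_0(M)$. Moreover, two elements $J_1,J_2\in\mathrm{Sek}_0(M)$ represent the same generalized almost contact structure $(E,L)$ if and only if they belong to the same $\mathrm{O}(E)$-orbit.
   Context: $\mathbb{T}M=TM\oplus T^*M$ carries the inner product $\langle X+\alpha,Y+\beta\rangle=\frac12(\alpha(Y)+\beta(X))$. A generalized almost contact structure on an odd-dimensional manifold $M$ is a pair $(E,L)$ where $E\simeq M\times\mathbb{R}^2$ is a trivial subbundle of $\mathbb{T}M$ such that $\langle\ ,\ \rangle|_E$ is nondegenerate of signature $(1,1)$, and $L$ is a maximal isotropic subbundle of $E^\perp\otimes\mathbb{C}$ with $L\cap\overline{L}=0$. Triviality of $E$ is understood as triviality as a bundle with inner product, i.e. $E$ has a global isotropic frame $\mathbf{e}_1,\mathbf{e}_2$ with $\langle\mathbf{e}_1,\mathbf{e}_2\rangle=1/2$. A triple $(\Phi,\mathbf{e}_1,\mathbf{e}_2)$ consists of a base-fixing bundle morphism $\Phi:\mathbb{T}M\to\mathbb{T}M$ and sections $\mathbf{e}_1,\mathbf{e}_2\in\Gamma(\mathbb{T}M)$ with $\langle\mathbf{e}_1,\mathbf{e}_1\rangle=\langle\mathbf{e}_2,\mathbf{e}_2\rangle=0$, $\langle\mathbf{e}_1,\mathbf{e}_2\rangle=1/2$, $\Phi^*=-\Phi$ (adjoint for $\langle\ ,\ \rangle$), $\Phi(\mathbf{e}_1)=\Phi(\mathbf{e}_2)=0$,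 $\Phi^2(\mathbf{x})=-\mathbf{x}+2\langle\mathbf{x},\mathbf{e}_1\rangle\mathbf{e}_2+2\langle\mathbf{x},\mathbf{e}_2\rangle\mathbf{e}_1$. It represents $(E,L)$ if $E=\mathrm{span}(\mathbf{e}_1,\mathbf{e}_2)$ and $L$ is the $\sqrt{-1}$-eigenbundle of $\Phi$ on $\mathbb{T}M\otimes\mathbb{C}$. Let $\mathcal{E}'(M)=\mathbb{T}M\oplus\mathrm{span}(\partial_t,dt)$, the bundle over $M$ obtained by restricting the generalized tangent bundle of the cone $C(M)=M\times(0,\infty)$ to $M\times\{1\}\equiv M$; its sections are $\mathbf{x}+f\partial_t+g\,dt$, $\mathbf{x}\in\Gamma(\mathbb{T}M)$, $f,g\in C^\infty(M)$, with inner product $\langle\mathbf{x}_1+f_1\partial_t+g_1dt,\mathbf{x}_2+f_2\partial_t+g_2dt\rangle=\langle\mathbf{x}_1,\mathbf{x}_2\rangle+\frac12(f_1g_2+f_2g_1)$. $\mathbb{R}^+$-invariant generalized almost complex structures on $C(M)$ are identified with base-preserving bundle morphisms $J:\mathcal{E}'(M)\to\mathcal{E}'(M)$ with $J^2=-\mathrm{Id}$, $J^*=-J$. $\mathrm{Sek}_0(M)$ is the set of such $J$ with $J(\mathrm{span}(\partial_t,dt))\subset\mathbb{T}M$. The triple associated to $J\in\mathrm{Sek}_0(M)$ is $\mathbf{e}_1=J(\partial_t)$, $\mathbf{e}_2=J(dt)$, and $\Phi(\mathbf{x})$ = the $\mathbb{T}M$-component of $J(\mathbf{x})$; this gives a bijection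 between $\mathrm{Sek}_0(M)$ and the set of triples. $J\in\mathrm{Sek}_0(M)$ represents $(E,L)$ if its associated triple does. $\mathrm{O}(E)\simeq C^\infty(M,\mathrm{O}(1,1))$ is the group of base-fixing bundle automorphisms of $E$ preserving the inner product. For a triple with $E=\mathrm{span}(\mathbf{e}_1,\mathbf{e}_2)$ it acts by $R\cdot(\Phi,\mathbf{e}_1,\mathbf{e}_2)=(\Phi,R\mathbf{e}_1,R\mathbf{e}_2)$; the action is transported to $\mathrm{Sek}_0(M)$ via the bijection between triples and $\mathrm{Sek}_0(M)$. *)

(* Defs.v *)
From HB Require Import structures.
From mathcomp Require Import all_boot all_order all_algebra.
From mathcomp Require Import complex.
From mathcomp Require Import boolp classical_sets functions cardinality reals.
From mathcomp Require Import topology normedtype derive.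

Set Implicit Arguments.
Unset Strict Implicit.
Unset Printing Implicit Defensive.

Import Order.TTheory GRing.Theory Num.Theory.
Import numFieldNormedType.Exports.

Local Open Scope classical_set_scope.
Local Open Scope ring_scope.

(* [C^k] on [U], meant for [U] open: [f] is Fréchet differentiable on [U] and
   its directional derivatives are [C^(k-1)] on [U]. *)
Fixpoint Ck_on {R : realType} {n : nat} {W : normedModType R}
    (k : nat) (U : set 'rV[R]_n) (f : 'rV[R]_n -> W) : Prop :=
  match k with
  | 0 => forall x, U x -> {for x, continuous f}
  | k'.+1 => (forall x, U x -> differentiable f x) /\
             (forall v, Ck_on k' U (fun x => 'D_v f x))
  end.

Definition smooth_on {R : realType} {n : nat} {W : normedModType R}
  (U : set 'rV[R]_n) (f : 'rV[R]_n -> W) : Prop := forall k, Ck_on k U f.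

(* [chart_inv] is only meaningful on [chart_map @` chart_dom]. *)
Record chart (R : realType) (n : nat) (T : topologicalType) := Chart {
  chart_dom : set T;
  chart_map :> T -> 'rV[R]_n;
  chart_inv : 'rV[R]_n -> T;
  chart_dom_open : open chart_dom;
  chart_img_open : open (chart_map @` chart_dom);
  chart_mapK : forall p, chart_dom p -> chart_inv (chart_map p) = p;
  chart_map_cont : {within chart_dom, continuous chart_map};
  chart_inv_cont : {within chart_map @` chart_dom, continuous chart_inv}
}.

Record smooth_manifold (R : realType) (n : nat) := SmoothManifold {
  mcarrier :> topologicalType;
  mhausdorff : hausdorff_space mcarrier;
  msecond_countable : @second_countable mcarrier;
  atlas : set (chart R n mcarrier);
  atlas_cover : forall p : mcarrier, exists c, atlas c /\ chart_dom c p;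
  atlas_smooth : forall c d, atlas c -> atlas d ->
    smooth_on (c @` (chart_dom c `&` chart_dom d)) (d \o chart_inv c)
}.

(* The fibre of [TM] at [p] is the space of coordinate vectors with respect to
   the chart [chart_at p], chosen once and for all in the atlas; the smooth
   structure of [TM] is carried by the changes of coordinates to all the other
   charts ([gframe] below), so this is not a trivialization of [TM]. *)
Definition chart_at (R : realType) (n : nat) (M : smooth_manifold R n) (p : M) :
  chart R n M := projT1 (cid (atlas_cover p)).

(* The element [X + alpha] of the fibre of [TM (+) T*M] at [p] is the row
   [row_mx X alpha], [alpha] being given by its coordinates in the basis dual to
   that of the tangent space, so that [alpha(X)] is [alpha *m X^T].  Over an
   extension field of [R] this is the bilinear extension of the pairing. *)
Definition pairing {F : fieldType} {n : nat} (x y : 'rV[F]_(n + n)) : F :=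
  2%:R^-1 * ((rsubmx x *m (lsubmx y)^T) 0 0 + (rsubmx y *m (lsubmx x)^T) 0 0).

(* Change of coordinates, acting on rows on the right, from [chart_at p] to
   the chart [c]: tangent vectors are pushed forward by the Jacobian ['J] of the
   transition map, covectors are pulled back by the inverse transition map. *)
Definition gframe {R : realType} {n : nat} {M : smooth_manifold R n}
    (c : chart R n M) (p : M) : 'M[R]_(n + n) :=
  let d := chart_at p in
  block_mx (jacobian (c \o chart_inv d) (d p)) 0
           0 (jacobian (d \o chart_inv c) (c p))^T.

(* [F c] is the expression in the chart [c] of some field over [M]; smoothness
   over the open set [V]. *)
Definition smooth_in_charts {R : realType} {n : nat} {M : smooth_manifold R n}
    {a b : nat} (V : set M) (F : chart R n M -> M -> 'M[R]_(a, b)) : Prop :=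
  forall c, atlas c ->
    smooth_on (c @` (chart_dom c `&` V)) (F c \o chart_inv c).

Definition smooth_section {R : realType} {n : nat} {M : smooth_manifold R n}
    (V : set M) (s : M -> 'rV[R]_(n + n)) : Prop :=
  smooth_in_charts V (fun c p => s p *m gframe c p).

Definition smooth_csection {R : realType} {n : nat} {M : smooth_manifold R n}
    (V : set M) (s : M -> 'rV[R[i]]_(n + n)) : Prop :=
  smooth_section V (fun p => map_mx (@complex.Re R) (s p)) /\
  smooth_section V (fun p => map_mx (@complex.Im R) (s p)).

(* Endomorphisms of a fibre are matrices acting on rows on the right. *)
Definition smooth_morphism {R : realType} {n : nat} {M : smooth_manifold R n}
    (Phi : M -> 'M[R]_(n + n)) : Prop :=
  smooth_in_charts [set: M]
    (fun c p => invmx (gframe c p) *m Phi p *m gframe c p).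

Definition isotropic_pair {R : realType} {n : nat} (u v : 'rV[R]_(n + n)) :
    Prop :=
  [/\ pairing u u = 0, pairing v v = 0 & pairing u v = 2%:R^-1].

Definition orth {R : realType} {n : nat} (U : {vspace 'rV[R]_(n + n)}) :
    set 'rV[R]_(n + n) :=
  [set x | forall y, y \in U -> pairing x y = 0].

Definition complexified {R : realType} {m : nat} (A : set 'rV[R]_m) :
    set 'rV[R[i]]_m :=
  [set z | A (map_mx (@complex.Re R) z) /\ A (map_mx (@complex.Im R) z)].

Definition conj_row {R : realType} {m : nat} (z : 'rV[R[i]]_m) : 'rV[R[i]]_m :=
  map_mx (@conjc R) z.

Definition signature11 {R : realType} {n : nat} (U : {vspace 'rV[R]_(n + n)}) :
    Prop :=
  exists u v, [/\ U = <<[:: u; v]>>%VS, pairing u u = 1, pairing v v = -1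
                & pairing u v = 0].

Definition isotropic {F : fieldType} {n : nat} (L : {vspace 'rV[F]_(n + n)}) :
    Prop :=
  forall x y, x \in L -> y \in L -> pairing x y = 0.

Definition maximal_isotropic_in {F : fieldType} {n : nat}
    (A : set 'rV[F]_(n + n)) (L : {vspace 'rV[F]_(n + n)}) : Prop :=
  [/\ isotropic L, forall x, x \in L -> A x
    & forall W : {vspace 'rV[F]_(n + n)},
        isotropic W -> (forall x, x \in W -> A x) -> (L <= W)%VS -> W = L].

Definition smooth_csubbundle {R : realType} {n : nat} {M : smooth_manifold R n}
    (L : M -> {vspace 'rV[R[i]]_(n + n)}) : Prop :=
  exists r : nat, forall p : M, exists V : set M, exists s : 'I_r -> M -> 'rV[R[i]]_(n + n),
    [/\ open V, V p, forall j, smooth_csection V (s j)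
      & forall q, V q -> basis_of (L q) [seq s j q | j <- enum 'I_r]].

Definition trivial_bundle11 {R : realType} {n : nat} {M : smooth_manifold R n}
    (E : M -> {vspace 'rV[R]_(n + n)}) : Prop :=
  exists e1 e2 : M -> 'rV[R]_(n + n),
    [/\ smooth_section [set: M] e1, smooth_section [set: M] e2,
        forall p, isotropic_pair (e1 p) (e2 p)
      & forall p, E p = <<[:: e1 p; e2 p]>>%VS].

Record gac_structure {R : realType} {n : nat} {M : smooth_manifold R n}
    (E : M -> {vspace 'rV[R]_(n + n)}) (L : M -> {vspace 'rV[R[i]]_(n + n)}) :
    Prop := GacStructure {
  gac_trivial : trivial_bundle11 E;
  gac_signature : forall p, signature11 (E p);
  gac_smooth : smooth_csubbundle L;
  gac_maximal : forall p, maximal_isotropic_in (complexified (orth (E p))) (L p);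
  gac_conj : forall p x, x \in L p -> conj_row x \in L p -> x = 0
}.

Record triple {R : realType} {n : nat} (M : smooth_manifold R n) := Triple {
  tPhi : M -> 'M[R]_(n + n);
  te1 : M -> 'rV[R]_(n + n);
  te2 : M -> 'rV[R]_(n + n)
}.

Record gac_triple {R : realType} {n : nat} {M : smooth_manifold R n}
    (T : triple M) : Prop := GacTriple {
  tPhi_smooth : smooth_morphism (tPhi T);
  te1_smooth : smooth_section [set: M] (te1 T);
  te2_smooth : smooth_section [set: M] (te2 T);
  te_isotropic : forall p, isotropic_pair (te1 T p) (te2 T p);
  tPhi_skew : forall p x y,
    pairing (x *m tPhi T p) y = - pairing x (y *m tPhi T p);
  tPhi_e1 : forall p, te1 T p *m tPhi T p = 0;
  tPhi_e2 : forall p, te2 T p *m tPhi T p = 0;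
  tPhi_sq : forall p x, x *m tPhi T p *m tPhi T p =
    - x + (2%:R * pairing x (te1 T p)) *: te2 T p
        + (2%:R * pairing x (te2 T p)) *: te1 T p
}.

Definition triple_span {R : realType} {n : nat} {M : smooth_manifold R n}
    (T : triple M) (p : M) : {vspace 'rV[R]_(n + n)} :=
  <<[:: te1 T p; te2 T p]>>%VS.

Definition triple_represents {R : realType} {n : nat} {M : smooth_manifold R n}
    (T : triple M) (E : M -> {vspace 'rV[R]_(n + n)})
    (L : M -> {vspace 'rV[R[i]]_(n + n)}) : Prop :=
  [/\ gac_triple T,
      forall p, E p = triple_span T p
    & forall p x, x \in L p <->
        x *m map_mx (real_complex R) (tPhi T p) = 'i%C *: x].

(* [x + f d/dt + g dt] *)
Definition evec {R : realType} {n : nat} (x : 'rV[R]_(n + n)) (f g : R) :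
  'rV[R]_(n + n + (1 + 1)) := row_mx x (row_mx f%:M g%:M).

Definition ebase {R : realType} {n : nat} (w : 'rV[R]_(n + n + (1 + 1))) :
  'rV[R]_(n + n) := lsubmx w.
Definition edt_vec {R : realType} {n : nat} (w : 'rV[R]_(n + n + (1 + 1))) : R :=
  lsubmx (rsubmx w) 0 0.
Definition edt_form {R : realType} {n : nat} (w : 'rV[R]_(n + n + (1 + 1))) : R :=
  rsubmx (rsubmx w) 0 0.

Definition epairing {R : realType} {n : nat}
    (v w : 'rV[R]_(n + n + (1 + 1))) : R :=
  pairing (ebase v) (ebase w)
  + 2%:R^-1 * (edt_vec v * edt_form w + edt_vec w * edt_form v).

Definition eframe {R : realType} {n : nat} {M : smooth_manifold R n}
    (c : chart R n M) (p : M) : 'M[R]_(n + n + (1 + 1)) :=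
  block_mx (gframe c p) 0 0 1%:M.

Definition smooth_emorphism {R : realType} {n : nat} {M : smooth_manifold R n}
    (J : M -> 'M[R]_(n + n + (1 + 1))) : Prop :=
  smooth_in_charts [set: M]
    (fun c p => invmx (eframe c p) *m J p *m eframe c p).

Record Sek0 {R : realType} {n : nat} {M : smooth_manifold R n}
    (J : M -> 'M[R]_(n + n + (1 + 1))) : Prop := InSek0 {
  sek_smooth : smooth_emorphism J;
  sek_sq : forall p, J p *m J p = - (1%:M);
  sek_skew : forall p v w, epairing (v *m J p) w = - epairing v (w *m J p);
  sek_span : forall p f g, exists x, evec 0 f g *m J p = evec x 0 0
}.

Definition triple_of {R : realType} {n : nat} {M : smooth_manifold R n}
    (J : M -> 'M[R]_(n + n + (1 + 1))) : triple M :=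
  Triple (fun p => \matrix_i ebase (evec (delta_mx 0 i) 0 0 *m J p))
         (fun p => ebase (evec 0 1 0 *m J p))
         (fun p => ebase (evec 0 0 1 *m J p)).

Definition represents {R : realType} {n : nat} {M : smooth_manifold R n}
    (J : M -> 'M[R]_(n + n + (1 + 1))) (E : M -> {vspace 'rV[R]_(n + n)})
    (L : M -> {vspace 'rV[R[i]]_(n + n)}) : Prop :=
  triple_represents (triple_of J) E L.

Definition bundle_endo {R : realType} {n : nat} {M : smooth_manifold R n}
    (E : M -> {vspace 'rV[R]_(n + n)}) : Type :=
  forall p : M, 'End(subvs_of (E p)).

(* Only meaningful if [s] is a section of [E]. *)
Definition endo_app {R : realType} {n : nat} {M : smooth_manifold R n}
    {E : M -> {vspace 'rV[R]_(n + n)}} (A : bundle_endo E)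
    (s : M -> 'rV[R]_(n + n)) (p : M) : 'rV[R]_(n + n) :=
  vsval (A p (vsproj (E p) (s p))).

Record in_OE {R : realType} {n : nat} {M : smooth_manifold R n}
    {E : M -> {vspace 'rV[R]_(n + n)}} (A : bundle_endo E) : Prop := InOE {
  OE_smooth : forall (V : set M) (s : M -> 'rV[R]_(n + n)), open V ->
    (forall p, V p -> s p \in E p) ->
    smooth_section V s -> smooth_section V (endo_app A s);
  OE_bij : forall p, bijective (A p);
  OE_isometry : forall p (u v : subvs_of (E p)),
    pairing (vsval (A p u)) (vsval (A p v)) = pairing (vsval u) (vsval v)
}.

Definition OE_act {R : realType} {n : nat} {M : smooth_manifold R n}
    {E : M -> {vspace 'rV[R]_(n + n)}} (A : bundle_endo E) (T : triple M) :
    triple M :=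
  Triple (tPhi T) (endo_app A (te1 T)) (endo_app A (te2 T)).

(* [O(E)] acts on those [J] whose triple spans [E], by transport of [OE_act]
   along the bijection [triple_of]. *)
Definition same_OE_orbit {R : realType} {n : nat} {M : smooth_manifold R n}
    (E : M -> {vspace 'rV[R]_(n + n)}) (J1 J2 : M -> 'M[R]_(n + n + (1 + 1))) :
    Prop :=
  (forall p, E p = triple_span (triple_of J1) p) /\
  exists A : bundle_endo E,
    in_OE A /\ triple_of J2 = OE_act A (triple_of J1).

(* Main.v *)
Require Import Defs.
From HB Require Import structures.
From mathcomp Require Import all_boot all_order all_algebra.
From mathcomp Require Import complex ring zify.
From mathcomp Require Import boolp classical_sets functions cardinality reals.
From mathcomp Require Import topology normedtype landau derive.

Import Order.TTheory GRing.Theory Num.Theory.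
Import numFieldNormedType.Exports.
Local Open Scope classical_set_scope.
Local Open Scope ring_scope.

Set Implicit Arguments.
Unset Strict Implicit.
Unset Printing Implicit Defensive.

(** An element [J] of [Sek0] is the same thing as its triple [(Phi, e1, e2)]: the
    components of [J] that the triple does not record are forced by
    skew-symmetry, and [J ^ 2 = - 1] becomes the equations of a triple
    ([cone_endo_triple], [cone_endo_sq]). So the claim is about triples.

    Given [(E, L)], choose an isotropic frame [e1, e2] of [E]. Maximality of [L]
    forces its dimension: if it were less than [n - 1], the orthogonal of [L] in
    the complexification of the orthogonal of [E] would be too large not to
    contain a null vector outside [L], because every complex plane contains one
    ([isotropic_vector], [fibre_corank]). Hence the space is the sum of [L], of its
    conjugate and of [E], and in each fibre there is exactly one real [Phi] that
    is multiplication by [i] on [L] and zero on [E] ([fibre_endo_exists],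
    [fibre_endo_uniq]). Isotropy of [L] makes [Phi] skew, and maximality makes [L]
    the whole eigenspace ([fibre_endo_triple], [fibre_endo_eigen]). Uniqueness
    makes [Phi] global, and it is smooth because its matrix solves a linear
    system whose coefficients come from local smooth frames
    ([smooth_morphism_frame]).

    If two triples represent the same [(E, L)], uniqueness gives them the same
    [Phi]; their frames of [E] are both isotropic and normalized, so exactly one
    endomorphism of [E] carries one to the other, and it is a smooth isometry
    ([frame_change_OE]). Conversely, [O(E)] leaves [Phi] unchanged, and what
    remains to be shown is that every triple represents some structure: its
    eigenbundle is maximal isotropic in the orthogonal of [E]
    ([fibre_triple_gac]), and it is a smooth subbundle because projecting
    suitable sections onto it yields local frames ([ieigen_smooth]).

    Smoothness is defined by iterated directional derivatives in charts. It is
    propagated to sums, products and inverses of functions, then to matrices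
    through determinants. Composition of smooth maps is avoided: a field is
    always studied in the chart at hand, and the coefficients of a change of
    chart are Jacobians of transition maps or inverses of such Jacobians. *)

(** * Calculus of smooth functions *)

(** Both the differential and its error term at [x] only see the germ of the
    function at [x]. *)
Lemma near_eq_differentiable {R : numFieldType} {V W : normedModType R}
    (f g : V -> W) (x : V) :
  {near x, f =1 g} -> differentiable f x -> differentiable g x.
Proof.
move=> fg df; have fgx : f x = g x by exact: nbhs_singleton fg.
have dfE := diff_locally df.
have gE : g \o shift x = cst (g x) + 'd f x +o_ 0 id.
  apply/eqaddoP => e e0; move/eqaddoP : dfE => /(_ e e0).
  have : \forall h \near (0 : V), f (h + x) = g (h + x).
    by move: fg; rewrite (near_shift 0 x); apply: filterS => h /=; rewrite subr0.
  by apply: filterS2 => h /= E; rewrite !fctE /= E fgx.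
apply/diff_locallyP; have cdf := diff_continuous df.
by rewrite (diff_unique cdf gE).
Qed.

Section SmoothCalculus.
Context {R : realType} {n : nat}.
Implicit Types (U V : set 'rV[R]_n) (k : nat).

Lemma Ck_on_sub {W : normedModType R} k U V (f : 'rV[R]_n -> W) :
  V `<=` U -> Ck_on k U f -> Ck_on k V f.
Proof.
move=> VU; elim: k f => [|k IHk] f /=; first by move=> fU x /VU /fU.
by case=> df Df; split=> [x /VU /df //|v]; apply: IHk.
Qed.

(** Openness of [U] is what makes [Ck_on] insensitive to values off [U]: the
    derivatives at a point of [U] depend on the function near that point. *)
Lemma Ck_on_ext {W : normedModType R} k U (f g : 'rV[R]_n -> W) :
  open U -> (forall x, U x -> f x = g x) -> Ck_on k U f -> Ck_on k U g.
Proof.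
move=> oU; have nU x : U x -> nbhs x U by move=> Ux; apply: open_nbhs_nbhs.
elim: k f g => [|k IHk] f g fg /= => [fU x Ux|[df Df]].
  have nfg : {near x, f =1 g} by apply: filterS (nU x Ux).
  have fgx : f @ x --> g x by rewrite -(fg x Ux); exact: fU.
  by apply: cvg_trans fgx; exact: near_eq_cvg nfg.
split=> [x Ux|v].
  by apply: near_eq_differentiable (df x Ux); apply: filterS (nU x Ux).
apply: IHk (Df v) => x Ux.
by apply: near_eq_derive; apply: filterS (nU x Ux).
Qed.

Lemma Ck_onW {W : normedModType R} k U (f : 'rV[R]_n -> W) :
  Ck_on k.+1 U f -> Ck_on k U f.
Proof.
elim: k f => [|k IHk] f [df Df].
  by move=> x Ux; apply: differentiable_continuous; apply: df.
by split=> // v; apply: IHk; apply: Df.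
Qed.

Lemma Ck_on_cst {W : normedModType R} k U (w : W) : Ck_on k U (fun=> w).
Proof.
elim: k w => [|k IHk] w; first by move=> x _; apply: cst_continuous.
split=> [x _|v]; first exact: differentiable_cst.
have -> : (fun x : 'rV[R]_n => 'D_v (fun=> w) x) = fun=> 0.
  by apply/funext => x; exact: derive_cst.
exact: IHk.
Qed.

Lemma Ck_onD {W : normedModType R} k U (f g : 'rV[R]_n -> W) : open U ->
  Ck_on k U f -> Ck_on k U g -> Ck_on k U (fun x => f x + g x).
Proof.
move=> oU; elim: k f g => [|k IHk] f g.
  by move=> cf cg x Ux; apply: continuousD; [apply: cf|apply: cg].
move=> [df Df] [dg Dg]; split=> [x Ux|v].
  by apply: differentiableD; [apply: df|apply: dg].
apply: Ck_on_ext (IHk _ _ (Df v) (Dg v)) => // x Ux.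
by rewrite -[LHS]deriveD //; apply: diff_derivable; [apply: df|apply: dg].
Qed.

Lemma Ck_on_lin {W W' : normedModType R} k U (l : {linear W -> W'})
    (f : 'rV[R]_n -> W) : continuous l -> open U ->
  Ck_on k U f -> Ck_on k U (fun x => l (f x)).
Proof.
move=> cl oU; elim: k f => [|k IHk] f.
  by move=> cf x Ux; apply: continuous_comp; [apply: cf|apply: cl].
move=> [df Df]; have dl y : differentiable l y by exact: linear_differentiable.
have dlf x : U x -> differentiable (fun x => l (f x)) x.
  by move=> Ux; apply: differentiable_comp => //; apply: df.
split=> // v; apply: Ck_on_ext (IHk _ (Df v)) => // x Ux.
rewrite (deriveE _ (df x Ux)) (deriveE _ (dlf x Ux)).
by rewrite (diff_comp (df x Ux) (dl _)) /= (diff_lin _ cl).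
Qed.

Lemma Ck_onM k U (f g : 'rV[R]_n -> R) : open U ->
  Ck_on k U f -> Ck_on k U g -> Ck_on k U (fun x => f x * g x).
Proof.
move=> oU; elim: k f g => [|k IHk] f g.
  by move=> cf cg x Ux; apply: continuousM; [apply: cf|apply: cg].
move=> Cf Cg; have [df Df] := Cf; have [dg Dg] := Cg; split=> [x Ux|v].
  by apply: differentiableM; [apply: df|apply: dg].
apply: (@Ck_on_ext _ _ _ (fun x => f x * 'D_v g x + g x * 'D_v f x)) => //.
  move=> x Ux; apply/esym; apply: (@deriveM _ _ f g).
    exact/diff_derivable/df.
  exact/diff_derivable/dg.
by apply: Ck_onD (IHk _ _ (Ck_onW Cf) (Dg v)) (IHk _ _ (Ck_onW Cg) (Df v)).
Qed.

Lemma Ck_onV k U (f : 'rV[R]_n -> R) : open U -> (forall x, U x -> f x != 0) ->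
  Ck_on k U f -> Ck_on k U (fun x => (f x)^-1).
Proof.
move=> oU f0; elim: k => [|k IHk].
  by move=> cf x Ux; apply: continuousV; [apply: f0|apply: cf].
move=> Cf; have [df Df] := Cf; split=> [x Ux|v].
  by apply: differentiableV; [apply: df|apply: f0].
have CV := IHk (Ck_onW Cf).
(* The derivative of the inverse is polynomial in the derivative and in the
   inverse itself, so one more degree of smoothness is gained. *)
apply: (@Ck_on_ext _ _ _ (fun x => -1 * ((f x)^-1 * (f x)^-1) * 'D_v f x)) => //.
  move=> x Ux; rewrite [RHS](@deriveV _ _ f) ?f0 //; last exact/diff_derivable/df.
  by rewrite mulN1r -exprVn.
by apply: Ck_onM (Df v) => //; do !apply: Ck_onM => //; apply: Ck_on_cst.
Qed.

End SmoothCalculus.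

Section SmoothMatrices.
Context {R : realType} {n : nat}.
Implicit Types (U V : set 'rV[R]_n).

Lemma smooth_on_sub {W : normedModType R} U V (f : 'rV[R]_n -> W) :
  V `<=` U -> smooth_on U f -> smooth_on V f.
Proof. by move=> VU sf k; apply: Ck_on_sub (sf k). Qed.

Lemma smooth_on_ext {W : normedModType R} U (f g : 'rV[R]_n -> W) :
  open U -> (forall x, U x -> f x = g x) -> smooth_on U f -> smooth_on U g.
Proof. by move=> oU fg sf k; apply: Ck_on_ext (sf k). Qed.

(** [Ck_on] only quantifies over single points, so there is nothing to glue. *)
Lemma smooth_on_bigcup {W : normedModType R} (f : 'rV[R]_n -> W) U :
  (forall x, U x -> exists2 V, V x & smooth_on V f) -> smooth_on U f.
Proof.
move=> loc k; elim: k f loc => [|k IHk] f loc /=.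
  by move=> x /loc[V Vx /(_ 0)]; apply.
split=> [x /loc[V Vx /(_ 1%N)[df _]]|v]; first exact: df.
by apply: IHk => x /loc[V Vx sf]; exists V => // m; have [_] := sf m.+1; apply.
Qed.

Lemma smooth_on_continuous {W : normedModType R} (f : 'rV[R]_n -> W) U x :
  smooth_on U f -> U x -> {for x, continuous f}.
Proof. by move=> /(_ 0); apply. Qed.

Lemma smooth_on_derive {W : normedModType R} U (f : 'rV[R]_n -> W) v :
  smooth_on U f -> smooth_on U (fun x => 'D_v f x).
Proof. by move=> sf k; have [_] := sf k.+1; apply. Qed.

Lemma smooth_on_cst {W : normedModType R} U (w : W) : smooth_on U (fun=> w).
Proof. by move=> k; apply: Ck_on_cst. Qed.

Lemma smooth_onD {W : normedModType R} U (f g : 'rV[R]_n -> W) : open U ->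
  smooth_on U f -> smooth_on U g -> smooth_on U (fun x => f x + g x).
Proof. by move=> oU sf sg k; apply: Ck_onD. Qed.

Lemma smooth_on_lin {W W' : normedModType R} U (l : {linear W -> W'})
    (f : 'rV[R]_n -> W) : continuous l -> open U ->
  smooth_on U f -> smooth_on U (fun x => l (f x)).
Proof. by move=> cl oU sf k; apply: Ck_on_lin. Qed.

Lemma smooth_onM U (f g : 'rV[R]_n -> R) : open U ->
  smooth_on U f -> smooth_on U g -> smooth_on U (fun x => f x * g x).
Proof. by move=> oU sf sg k; apply: Ck_onM. Qed.

Lemma smooth_onV U (f : 'rV[R]_n -> R) : open U -> (forall x, U x -> f x != 0) ->
  smooth_on U f -> smooth_on U (fun x => (f x)^-1).
Proof. by move=> oU f0 sf k; apply: Ck_onV. Qed.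

Lemma smooth_on_sum {W : normedModType R} U I (r : seq I)
    (F : I -> 'rV[R]_n -> W) : open U ->
  (forall i, smooth_on U (F i)) -> smooth_on U (fun x => \sum_(i <- r) F i x).
Proof.
move=> oU sF; elim: r => [|i r IHr].
  by apply: smooth_on_ext (smooth_on_cst U 0) => // x _; rewrite big_nil.
by apply: smooth_on_ext (smooth_onD oU (sF i) IHr) => // x _; rewrite big_cons.
Qed.

Lemma smooth_on_prod U I (r : seq I) (F : I -> 'rV[R]_n -> R) : open U ->
  (forall i, smooth_on U (F i)) -> smooth_on U (fun x => \prod_(i <- r) F i x).
Proof.
move=> oU sF; elim: r => [|i r IHr].
  by apply: smooth_on_ext (smooth_on_cst U (1 : R)) => // x _; rewrite big_nil.
by apply: smooth_on_ext (smooth_onM oU (sF i) IHr) => // x _; rewrite big_cons.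
Qed.

Lemma smooth_on_mxP {a b} U (F : 'rV[R]_n -> 'M[R]_(a, b)) : open U ->
  smooth_on U F <-> forall i j, smooth_on U (fun x => F x i j).
Proof.
move=> oU; split=> [sF i j|sF].
  have @l : {linear 'M[R]_(a, b) -> R}.
    by exists (fun N : 'M[R]_(_, _) => N i j); do 2![eexists]; do ?[constructor];
       rewrite ?mxE// => ? *; rewrite ?mxE//; move=> ?; rewrite !mxE.
  by apply: (smooth_on_lin (l := l)) => //; apply: coord_continuous.
apply: (@smooth_on_ext _ _
  (fun x => \sum_i \sum_j F x i j *: (delta_mx i j : 'M[R]_(a, b)))) => //.
  by move=> x _; rewrite -matrix_sum_delta.
apply: smooth_on_sum => // i; apply: smooth_on_sum => // j.
have s_lin : linear (fun k : R => k *: (delta_mx i j : 'M[R]_(a, b))).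
  by move=> k u v; rewrite scalerDl scalerA.
pose sM := GRing.isLinear.Build _ _ _ _ _ s_lin.
pose l : {linear R -> 'M[R]_(a, b)} := HB.pack ( *:%R ^~ (delta_mx i j)) sM.
by apply: (smooth_on_lin (l := l)) => //; apply: scalel_continuous.
Qed.

Lemma smooth_on_mulmx {a b c} U (F : 'rV[R]_n -> 'M[R]_(a, b))
    (G : 'rV[R]_n -> 'M[R]_(b, c)) : open U ->
  smooth_on U F -> smooth_on U G -> smooth_on U (fun x => F x *m G x).
Proof.
move=> oU /smooth_on_mxP sF /smooth_on_mxP sG; apply/smooth_on_mxP => // i j.
apply: (@smooth_on_ext _ _ (fun x => \sum_k F x i k * G x k j)) => //.
  by move=> x _; rewrite [RHS]mxE.
by apply: smooth_on_sum => // k; apply: smooth_onM => //; [apply: sF|apply: sG].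
Qed.

Lemma smooth_on_det {a} U (F : 'rV[R]_n -> 'M[R]_a) : open U ->
  smooth_on U F -> smooth_on U (fun x => \det (F x)).
Proof.
move=> oU /smooth_on_mxP sF; apply: smooth_on_sum => // s.
by apply: smooth_onM => //; [apply: smooth_on_cst|apply: smooth_on_prod => // i; apply: sF].
Qed.

Lemma smooth_on_invmx {a} U (F : 'rV[R]_n -> 'M[R]_a) : open U ->
  (forall x, U x -> F x \in unitmx) ->
  smooth_on U F -> smooth_on U (fun x => invmx (F x)).
Proof.
move=> oU uF sF; have /smooth_on_mxP sFe := sF; apply/smooth_on_mxP => // i j.
apply: (@smooth_on_ext _ _ (fun x => (\det (F x))^-1 * \adj (F x) i j)) => //.
  by move=> x Ux; rewrite /invmx uF // [RHS]mxE.
apply: smooth_onM => //; first apply: smooth_onV => //.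
- by move=> x Ux; rewrite -unitfE -unitmxE; apply: uF.
- exact: smooth_on_det.
apply: (@smooth_on_ext _ _ (fun x => (-1) ^+ (j + i) * \det (row' j (col' i (F x))))) => //.
  by move=> x _; rewrite [RHS]mxE.
apply: smooth_onM => //; first exact: smooth_on_cst.
apply: smooth_on_det => //; apply/smooth_on_mxP => // k l.
by apply: smooth_on_ext (sFe oU (lift j k) (lift i l)) => // x _; rewrite !mxE.
Qed.

(** Cramer's rule with parameters. The equality of [m] and [d] is a hypothesis
    because in the applications [B] has one row for each vector of two frames,
    and that their number is the dimension of the space is a theorem. *)
Lemma smooth_on_solve {m d e} U (B : 'rV[R]_n -> 'M[R]_(m, d))
    (C : 'rV[R]_n -> 'M[R]_(m, e)) (X : 'rV[R]_n -> 'M[R]_(d, e)) :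
  m = d -> open U -> (forall x, U x -> row_free (B x)) ->
  (forall x, U x -> B x *m X x = C x) ->
  smooth_on U B -> smooth_on U C -> smooth_on U X.
Proof.
move=> md oU; subst m => fB BX sB sC.
have uB x : U x -> B x \in unitmx by move=> Ux; rewrite -row_free_unit fB.
apply: (@smooth_on_ext _ _ (fun x => invmx (B x) *m C x)) => //.
  by move=> x Ux; rewrite -BX // mulKmx ?uB.
by apply: smooth_on_mulmx => //; apply: smooth_on_invmx.
Qed.

(** For functions whose entries are among those of a smooth function: blocks,
    transposes. *)
Lemma smooth_on_lift {a b a' b'} U (F : 'rV[R]_n -> 'M[R]_(a, b))
    (G : 'rV[R]_n -> 'M[R]_(a', b')) : open U ->
  (forall i j, exists i' j', forall x, U x -> F x i' j' = G x i j) ->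
  smooth_on U F -> smooth_on U G.
Proof.
move=> oU FG /smooth_on_mxP sF; apply/smooth_on_mxP => // i j.
have [i' [j' E]] := FG i j.
exact: smooth_on_ext oU E (sF oU i' j').
Qed.

Lemma smooth_on_tr {a b} U (F : 'rV[R]_n -> 'M[R]_(a, b)) : open U ->
  smooth_on U F -> smooth_on U (fun x => (F x)^T).
Proof. by move=> oU; apply: smooth_on_lift => // i j; exists j, i => x _; rewrite mxE. Qed.

Lemma smooth_on_row_mx {a b c} U (F : 'rV[R]_n -> 'M[R]_(a, b))
    (G : 'rV[R]_n -> 'M[R]_(a, c)) : open U ->
  smooth_on U F -> smooth_on U G -> smooth_on U (fun x => row_mx (F x) (G x)).
Proof.
move=> oU /smooth_on_mxP sF /smooth_on_mxP sG; apply/smooth_on_mxP => // i j.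
case: (split_ordP j) => k ->.
  by apply: smooth_on_ext (sF oU i k) => // x _; rewrite row_mxEl.
by apply: smooth_on_ext (sG oU i k) => // x _; rewrite row_mxEr.
Qed.

Lemma smooth_on_col_mx {a b c} U (F : 'rV[R]_n -> 'M[R]_(b, a))
    (G : 'rV[R]_n -> 'M[R]_(c, a)) : open U ->
  smooth_on U F -> smooth_on U G -> smooth_on U (fun x => col_mx (F x) (G x)).
Proof.
move=> oU sF sG; apply: (@smooth_on_ext _ _ (fun x => (row_mx (F x)^T (G x)^T)^T)) => //.
  by move=> x _; rewrite tr_row_mx !trmxK.
by apply: smooth_on_tr => //; apply: smooth_on_row_mx => //; apply: smooth_on_tr.
Qed.

Lemma smooth_on_jacobian {m} U (f : 'rV[R]_n -> 'rV[R]_m) : open U ->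
  smooth_on U f -> smooth_on U (jacobian f).
Proof.
move=> oU sf; apply/smooth_on_mxP => // i j.
apply: (@smooth_on_ext _ _ (fun x => 'D_(delta_mx 0 i) f x 0 j)) => //.
  move=> x Ux; have [df _] := sf 1%N.
  by rewrite deriveEjacobian -?rowE ?mxE //; apply: df.
by have /smooth_on_mxP := smooth_on_derive (delta_mx 0 i) sf; apply.
Qed.

Lemma near_eq_jacobian {m k} (f g : 'rV[R]_m -> 'rV[R]_k) x :
  {near x, f =1 g} -> differentiable f x -> jacobian f x = jacobian g x.
Proof.
move=> fg df; have dg := near_eq_differentiable fg df.
apply/row_matrixP => i; rewrite [LHS]rowE [RHS]rowE.
rewrite -[LHS](deriveEjacobian _ df).
rewrite -[RHS](deriveEjacobian _ dg).
exact: near_eq_derive fg.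
Qed.

Lemma jacobian_id {m} (x : 'rV[R]_m) : jacobian id x = 1%:M.
Proof.
by apply/row_matrixP => i; rewrite [LHS]rowE mul_rV_lin1 diff_val [RHS]rowE mulmx1.
Qed.

Lemma jacobian_comp {m k l} (f : 'rV[R]_m -> 'rV[R]_k) (g : 'rV[R]_k -> 'rV[R]_l) x :
  differentiable f x -> differentiable g (f x) ->
  jacobian (g \o f) x = jacobian f x *m jacobian g (f x).
Proof.
move=> df dg; apply/row_matrixP => i; rewrite row_mul !rowE.
by rewrite !mul_rV_lin1 diff_comp.
Qed.

End SmoothMatrices.

(* From here on, only the chain rule for Jacobians matters. *)
#[local] Opaque jacobian.

(** * The pairing and changes of charts *)

Section Pairing.
Context {F : fieldType} {n : nat}.
Implicit Types (x y z : 'rV[F]_(n + n)).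

(** Up to the factor 1/2, the Gram matrix of [pairing]. *)
Definition gram : 'M[F]_(n + n) := block_mx 0 1%:M 1%:M 0.

Lemma gram_sq : gram *m gram = 1%:M.
Proof.
by rewrite mulmx_block !mul0mx !mulmx0 !mulmx1 !addr0 !add0r -scalar_mx_block.
Qed.

Lemma pairingE x y : pairing x y = 2%:R^-1 * (x *m gram *m y^T) 0 0.
Proof.
rewrite /pairing; congr (_ * _).
rewrite -{3}(hsubmxK x) -{3}(hsubmxK y) mul_row_block !mulmx0 !mulmx1 add0r addr0.
rewrite tr_row_mx mul_row_col [in RHS]mxE; congr (_ + _).
by rewrite -[lsubmx x in RHS]trmxK -trmx_mul [RHS]mxE.
Qed.

Lemma pairingC x y : pairing x y = pairing y x.
Proof. by rewrite /pairing addrC. Qed.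

Lemma pairingDl x y z : pairing (x + y) z = pairing x z + pairing y z.
Proof. by rewrite !pairingE !mulmxDl [X in _ * X]mxE mulrDr. Qed.

Lemma pairingZl a x y : pairing (a *: x) y = a * pairing x y.
Proof. by rewrite !pairingE -!scalemxAl [X in _ * X]mxE mulrCA. Qed.

Lemma pairingNl x y : pairing (- x) y = - pairing x y.
Proof. by rewrite -scaleN1r pairingZl mulN1r. Qed.

Lemma pairing0l y : pairing 0 y = 0.
Proof. by rewrite -(scale0r 0) pairingZl mul0r. Qed.

Lemma pairingDr x y z : pairing x (y + z) = pairing x y + pairing x z.
Proof. by rewrite pairingC pairingDl !(pairingC x). Qed.

Lemma pairingZr a x y : pairing x (a *: y) = a * pairing x y.
Proof. by rewrite pairingC pairingZl pairingC. Qed.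

Lemma pairingNr x y : pairing x (- y) = - pairing x y.
Proof. by rewrite pairingC pairingNl pairingC. Qed.

Lemma pairing0r x : pairing x 0 = 0.
Proof. by rewrite pairingC pairing0l. Qed.

Definition pairingE_lin :=
  (pairingDl, pairingDr, pairingZl, pairingZr, pairingNl, pairingNr,
   pairing0l, pairing0r).

Lemma pairing_nondegenerate x : 2%:R != 0 :> F ->
  (forall y, pairing x y = 0) -> x = 0.
Proof.
move=> two0 x0; rewrite -[x]mulmx1 -gram_sq mulmxA.
suff -> : x *m gram = 0 by rewrite mul0mx.
apply/rowP => j; have /eqP := x0 (delta_mx 0 j).
rewrite pairingE mulf_eq0 invr_eq0 (negbTE two0) /= trmx_delta -colE mxE.
by move/eqP->; rewrite mxE.
Qed.

Lemma pairing_mulmx (g : 'M[F]_(n + n)) x y : g *m gram *m g^T = gram ->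
  pairing (x *m g) (y *m g) = pairing x y.
Proof. by move=> gE; rewrite !pairingE -[in RHS]gE trmx_mul !mulmxA. Qed.

End Pairing.
Arguments gram {F n}.

Section Charts.
Context {R : realType} {n : nat} {M : smooth_manifold R n}.
Implicit Types (a b c d : chart R n M) (p q : M) (V : set M).

Lemma open_chart_image c V : open V -> open (c @` (chart_dom c `&` V)).
Proof.
move=> oV.
have -> : c @` (chart_dom c `&` V) = (c @` chart_dom c) `&` chart_inv c @^-1` V.
  rewrite eqEsubset; split=> [_ [p [cp Vp] <-]|_ [[p cp <-] /=]].
    by split; [exists p|rewrite /= chart_mapK].
  by rewrite chart_mapK // => Vp; exists p.
have oi := @chart_img_open _ _ _ c.
have := @chart_inv_cont _ _ _ c; rewrite continuous_open_subspace // => ci.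
rewrite openE => y [cy Vy]; apply: filterI; first exact: open_nbhs_nbhs.
by apply: ci; [rewrite inE|apply: open_nbhs_nbhs].
Qed.

Lemma open_chart_overlap c d : open (c @` (chart_dom c `&` chart_dom d)).
Proof. exact/open_chart_image/chart_dom_open. Qed.

Lemma chart_continuous c p : chart_dom c p -> {for p, continuous c}.
Proof.
have := @chart_map_cont _ _ _ c; rewrite continuous_open_subspace; last exact: chart_dom_open.
by move=> cc cp; apply: cc; rewrite inE.
Qed.

Lemma chart_at_atlas p : atlas (chart_at p).
Proof. by rewrite /chart_at; case: (projT2 (cid (atlas_cover p))). Qed.

Lemma chart_at_dom p : chart_dom (chart_at p) p.
Proof. by rewrite /chart_at; case: (projT2 (cid (atlas_cover p))). Qed.

Definition trans_jac c d p : 'M[R]_n := jacobian (d \o chart_inv c) (c p).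

Lemma trans_differentiable c d p : atlas c -> atlas d ->
  chart_dom c p -> chart_dom d p -> differentiable (d \o chart_inv c) (c p).
Proof.
move=> ac ad cp dp; have [+ _] := atlas_smooth ac ad 1%N.
by apply; exists p.
Qed.

(** The chain rule, read from left to right since matrices act on rows. *)
Lemma trans_jac_cocycle a b c p : atlas a -> atlas b -> atlas c ->
  chart_dom a p -> chart_dom b p -> chart_dom c p ->
  trans_jac a b p *m trans_jac b c p = trans_jac a c p.
Proof.
move=> Aa Ab Ac ap bp cp.
have dab := trans_differentiable Aa Ab ap bp.
have dbc := trans_differentiable Ab Ac bp cp.
have ebp : (b \o chart_inv a) (a p) = b p by rewrite /= chart_mapK.
have dbc' : differentiable (c \o chart_inv b) ((b \o chart_inv a) (a p)).
  by rewrite ebp.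
have := jacobian_comp dab dbc'; rewrite ebp => <-.
apply: near_eq_jacobian (differentiable_comp dab dbc').
have nU : nbhs (a p) (a @` (chart_dom a `&` chart_dom b)).
  by apply: open_nbhs_nbhs; split; [apply: open_chart_overlap|exists p].
by apply: filterS nU => _ [q [aq bq] <-] /=; rewrite !chart_mapK.
Qed.

Lemma trans_jac_refl a p : chart_dom a p -> trans_jac a a p = 1%:M.
Proof.
move=> ap; have nU : nbhs (a p) (a @` (chart_dom a)).
  by apply: open_nbhs_nbhs; split; [apply: chart_img_open|exists p].
rewrite /trans_jac -(@near_eq_jacobian _ _ _ id); last exact: ex_diff.
  exact: jacobian_id.
by apply: filterS nU => _ [q aq <-] /=; rewrite chart_mapK.
Qed.

Lemma trans_jacK a b p : atlas a -> atlas b -> chart_dom a p -> chart_dom b p ->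
  trans_jac a b p *m trans_jac b a p = 1%:M.
Proof. by move=> *; rewrite trans_jac_cocycle // trans_jac_refl. Qed.

Lemma gframeE c p : gframe c p =
  block_mx (trans_jac (chart_at p) c p) 0 0 (trans_jac c (chart_at p) p)^T.
Proof. by []. Qed.

Lemma gframe_mulV c p : atlas c -> chart_dom c p ->
  gframe c p *m block_mx (trans_jac c (chart_at p) p) 0
                         0 (trans_jac (chart_at p) c p)^T = 1%:M.
Proof.
move=> ac cp; have [ak kp] := (chart_at_atlas p, chart_at_dom p).
rewrite gframeE mulmx_block !mul0mx !mulmx0 !addr0 !add0r.
by rewrite -trmx_mul !trans_jacK // trmx1 -scalar_mx_block.
Qed.

Lemma gframe_unit c p : atlas c -> chart_dom c p -> gframe c p \in unitmx.
Proof. move=> ac cp; have [ug _] := mulmx1_unit (gframe_mulV ac cp); exact: ug. Qed.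

(** Vectors are pushed forward while covectors are pulled back, so the
    evaluation of covectors on vectors is unchanged. *)
Lemma gframe_isometry c p : atlas c -> chart_dom c p ->
  gframe c p *m gram *m (gframe c p)^T = gram.
Proof.
move=> ac cp; have [ak kp] := (chart_at_atlas p, chart_at_dom p).
rewrite gframeE tr_block_mx !trmx0 trmxK !mulmx_block.
rewrite !mul0mx !mulmx0 !mulmx1 ?mul0mx ?addr0 ?add0r.
by rewrite -trmx_mul !trans_jacK // trmx1 !mul0mx.
Qed.

(** The chart chosen at [p] drops out, so that the regularity of changes of
    coordinates is that of the transition maps of the atlas. *)
Lemma gframe_change c d p : atlas c -> atlas d -> chart_dom c p -> chart_dom d p ->
  invmx (gframe c p) *m gframe d p =
  block_mx (trans_jac c d p) 0 0 (trans_jac d c p)^T.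
Proof.
move=> ac ad cp dp; have [ak kp] := (chart_at_atlas p, chart_at_dom p).
apply: (canLR (mulKmx (gframe_unit ac cp))).
rewrite !gframeE mulmx_block !mul0mx !mulmx0 !addr0 !add0r -trmx_mul.
by rewrite -(trans_jac_cocycle ak ac ad kp cp dp) -(trans_jac_cocycle ad ac ak dp cp kp).
Qed.


(** Constant coefficients in one chart have smooth coefficients in every other
    one; the Jacobian of the inverse transition is obtained by inverting a
    matrix, so that no chain rule for higher derivatives is involved. *)
Lemma smooth_section_chart_const (c : chart R n M) v : atlas c ->
  smooth_section (chart_dom c) (fun p : M => v *m invmx (gframe c p)).
Proof.
move=> ac d ad; have oU := open_chart_overlap (c := d) (d := c).
have sT := smooth_on_jacobian oU (atlas_smooth ad ac).
have sTV : smooth_on (d @` (chart_dom d `&` chart_dom c)) (fun y => trans_jac c d (chart_inv d y)).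
  apply: (smooth_on_solve (erefl n) oU _ _ sT (smooth_on_cst _ 1%:M)).
    move=> _ [p [dp cp] <-]; rewrite row_free_unit.
    have [uT _] := mulmx1_unit (trans_jacK ad ac dp cp); exact: uT.
  by move=> _ [p [dp cp] <-]; rewrite chart_mapK //; exact: trans_jacK.
have sB : smooth_on (d @` (chart_dom d `&` chart_dom c)) (fun y =>
  block_mx (trans_jac c d (chart_inv d y)) 0 0 (jacobian (c \o chart_inv d) y)^T).
  apply: (smooth_on_col_mx oU).
    exact: smooth_on_row_mx oU sTV (smooth_on_cst _ _).
  exact: smooth_on_row_mx oU (smooth_on_cst _ _) (smooth_on_tr oU sT).
apply: (smooth_on_ext oU _ (smooth_on_mulmx oU (smooth_on_cst _ v) sB)).
move=> _ [p [dp cp] <-] /=.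
rewrite (chart_mapK dp).
rewrite -mulmxA.
rewrite (gframe_change ac ad cp dp). reflexivity.

Qed.
End Charts.

(** * Complex vectors as pairs of real ones *)

Section ComplexRows.
Context {R : realType}.

Definition cx {a b} (A B : 'M[R]_(a, b)) : 'M[R[i]]_(a, b) :=
  map_mx (real_complex R) A + 'i%C *: map_mx (real_complex R) B.

Lemma cxE {a b} (A B : 'M[R]_(a, b)) i j : cx A B i j = Complex (A i j) (B i j).
Proof.
rewrite !mxE; apply/eqP; rewrite eq_complex /= !(mul0r, mul1r, mulr0, subr0).
by rewrite !(add0r, addr0) !eqxx.
Qed.

Lemma cx_ReIm {a b} (Z : 'M[R[i]]_(a, b)) :
  cx (map_mx (@complex.Re R) Z) (map_mx (@complex.Im R) Z) = Z.
Proof. by apply/matrixP => i j; rewrite cxE !mxE; case: (Z i j). Qed.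

Lemma Re_cx {a b} (A B : 'M[R]_(a, b)) : map_mx (@complex.Re R) (cx A B) = A.
Proof. by apply/matrixP => i j; rewrite mxE cxE. Qed.

Lemma Im_cx {a b} (A B : 'M[R]_(a, b)) : map_mx (@complex.Im R) (cx A B) = B.
Proof. by apply/matrixP => i j; rewrite mxE cxE. Qed.

Lemma cx_inj {a b} (A B A' B' : 'M[R]_(a, b)) :
  cx A B = cx A' B' -> A = A' /\ B = B'.
Proof.
by move=> E; split; [rewrite -(Re_cx A B) E Re_cx|rewrite -(Im_cx A B) E Im_cx].
Qed.

Lemma cx0 {a b} : cx 0 0 = 0 :> 'M[R[i]]_(a, b).
Proof. by rewrite /cx !map_mx0 scaler0 addr0. Qed.

Lemma cxD {a b} (A B A' B' : 'M[R]_(a, b)) :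
  cx A B + cx A' B' = cx (A + A') (B + B').
Proof. by rewrite /cx !map_mxD scalerDr addrACA. Qed.

Lemma scale_i_i {a b} (Z : 'M[R[i]]_(a, b)) : 'i%C *: ('i%C *: Z) = - Z.
Proof. by rewrite scalerA -expr2 sqr_i scaleN1r. Qed.

Lemma cx_scale_i {a b} (A B : 'M[R]_(a, b)) : 'i%C *: cx A B = cx (- B) A.
Proof. by rewrite /cx scalerDr scale_i_i map_mxN addrC. Qed.

Lemma cx_mulmx {a b c} (A B : 'M[R]_(a, b)) (A' B' : 'M[R]_(b, c)) :
  cx A B *m cx A' B' = cx (A *m A' - B *m B') (A *m B' + B *m A').
Proof.
rewrite /cx mulmxDl !mulmxDr -!scalemxAl -!scalemxAr scale_i_i -!map_mxM.
set P := map_mx _ (A *m A'); set Q := map_mx _ (A *m B').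
set S := map_mx _ (B *m A'); set T := map_mx _ (B *m B').
have -> : map_mx (real_complex R) (A *m A' - B *m B') = P - T by exact: map_mxB.
have -> : map_mx (real_complex R) (A *m B' + B *m A') = Q + S by exact: map_mxD.
by rewrite scalerDr (addrC ('i%C *: S)) addrACA.
Qed.

Lemma cx_mulmx_real {a b c} (A B : 'M[R]_(a, b)) (P : 'M[R]_(b, c)) :
  cx A B *m map_mx (real_complex R) P = cx (A *m P) (B *m P).
Proof. by rewrite /cx mulmxDl -scalemxAl -!map_mxM. Qed.

Lemma conj_cx {m} (u v : 'rV[R]_m) : conj_row (cx u v) = cx u (- v).
Proof. by apply/matrixP => i j; rewrite mxE !cxE mxE. Qed.

Lemma real_complex_pairing {n} (x y : 'rV[R]_(n + n)) :
  pairing (map_mx (real_complex R) x) (map_mx (real_complex R) y)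
  = real_complex R (pairing x y).
Proof.
rewrite /pairing -!map_lsubmx -!map_rsubmx !map_trmx -!map_mxM ![map_mx _ _ 0 0]mxE.
by rewrite -rmorphD -(rmorph_nat (real_complex R)) -fmorphV -rmorphM.
Qed.

Lemma pairing_cx {n} (u v u' v' : 'rV[R]_(n + n)) :
  pairing (cx u v) (cx u' v')
  = Complex (pairing u u' - pairing v v') (pairing u v' + pairing v u').
Proof.
rewrite /cx !pairingE_lin !real_complex_pairing; apply/eqP.
rewrite eq_complex /= !(mul0r, mul1r, mulr0, subr0, add0r, addr0, sub0r).
by rewrite !eqxx.
Qed.

Lemma eigen_cx {m} (u v : 'rV[R]_m) (P : 'M[R]_m) :
  cx u v *m map_mx (real_complex R) P = 'i%C *: cx u v <->
  u *m P = - v /\ v *m P = u.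
Proof.
rewrite cx_mulmx_real cx_scale_i; split=> [/cx_inj //|[-> ->] //].
Qed.

Lemma two_neq0 : 2%:R != 0 :> R. Proof. by rewrite pnatr_eq0. Qed.

Lemma ctwo_neq0 : 2%:R != 0 :> R[i]. Proof. by rewrite pnatr_eq0. Qed.

(** On the affine line through [y] with direction [x], where [x] is not null
    and [y] is not a multiple of [x], the quadratic form is a polynomial of
    degree two, which has a root over the complex numbers. *)
Lemma isotropic_vector {n} (U : {vspace 'rV[R[i]]_(n + n)}) : (1 < \dim U)%N ->
  exists x, [/\ x \in U, x != 0 & pairing x x = 0].
Proof.
move=> dU; pose x := vpick U.
have x0 : x != 0 by rewrite vpick0 -dimv_eq0 -lt0n ltnW.
have Ux : x \in U by exact: memv_pick.
have [xx0|xx] := eqVneq (pairing x x) 0; first by exists x.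
pose y := vpick (U :\: <[x]>).
have y0 : y != 0.
  rewrite vpick0 diffv_eq0; apply: contraL dU => /dimvS; rewrite dim_vline x0.
  by rewrite -leqNgt.
have Dy : y \in (U :\: <[x]>)%VS by exact: memv_pick.
have Uy : y \in U by exact: (subvP (diffvSl _ _)) Dy.
pose b := pairing x y; pose k := pairing x x.
(* A root of [k t ^ 2 + 2 b t + pairing y y]. *)
pose t := (sqrtc (b ^+ 2 - k * pairing y y) - b) / k.
exists (y + t *: x); split.
- by rewrite memvD // memvZ.
- apply: contra y0 => /eqP yx; rewrite -memv0 -(capv_diff U <[x]>) memv_cap Dy /=.
  apply/vlineP; exists (- t).
  by apply/eqP; rewrite scaleNr -addr_eq0 yx.
- have kt : k * t = sqrtc (b ^+ 2 - k * pairing y y) - b by rewrite mulrC divfK.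
  apply: (mulfI xx); rewrite mulr0 !pairingE_lin -/k -/b (pairingC y x) -/b.
  rewrite -/k.
  have -> : k * (pairing y y + t * b + (t * b + t * (t * k)))
    = k * pairing y y + 2%:R * (k * t) * b + (k * t) ^+ 2 by ring.
  rewrite kt; set s := sqrtc _.
  have -> : k * pairing y y + 2%:R * (s - b) * b + (s - b) ^+ 2
    = s ^+ 2 - (b ^+ 2 - k * pairing y y) by ring.
  by rewrite sqr_sqrtc subrr.
Qed.
End ComplexRows.

(** * Linear algebra of a generalized almost contact structure in one fibre *)

Section Fibre.
Context {R : realType} {n : nat}.
Implicit Types (e x y : 'rV[R]_(n + n)) (L W : {vspace 'rV[R[i]]_(n + n)}).

(** What a generalized almost contact structure says about one fibre, the
    isotropic frame [e1, e2] of [E] being given; smoothness is left aside, so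
    that the linear algebra takes place at a single point. *)
Record fibre_gac (e1 e2 : 'rV[R]_(n + n)) L : Prop := FibreGac {
  fibre_pair : isotropic_pair e1 e2;
  fibre_max : maximal_isotropic_in (complexified (orth <<[:: e1; e2]>>)) L;
  fibre_conj : forall z, z \in L -> conj_row z \in L -> z = 0
}.

Lemma span2P {F : fieldType} {vT : vectType F} (a b v : vT) :
  reflect (exists k l, v = k *: a + l *: b) (v \in <<[:: a; b]>>%VS).
Proof.
rewrite span_cons span_seq1; apply: (iffP memv_addP) => [[_ /vlineP[k ->]]|[k [l ->]]].
  by case=> _ /vlineP[l ->] ->; exists k, l.
by exists (k *: a); [|exists (l *: b)] => //; apply/vlineP; [exists k|exists l].
Qed.

Lemma orth_span2 (e1 e2 : 'rV[R]_(n + n)) x :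
  orth <<[:: e1; e2]>> x <-> pairing x e1 = 0 /\ pairing x e2 = 0.
Proof.
split=> [xE|[x1 x2] _ /span2P[k [l ->]]]; last first.
  by rewrite !pairingE_lin x1 x2 !mulr0 addr0.
split; apply: xE; apply/span2P.
  by exists 1, 0; rewrite scale1r scale0r addr0.
by exists 0, 1; rewrite scale1r scale0r add0r.
Qed.

Lemma complexified_orth_span2 (e1 e2 : 'rV[R]_(n + n)) (u v : 'rV[R]_(n + n)) :
  complexified (orth <<[:: e1; e2]>>) (cx u v) <->
  [/\ pairing u e1 = 0, pairing u e2 = 0, pairing v e1 = 0 & pairing v e2 = 0].
Proof.
rewrite /complexified /= Re_cx Im_cx !orth_span2.
by split=> [[[? ?] [? ?]]|[? ? ? ?]].
Qed.

Lemma row_free_inj0 {F : fieldType} {m d} (B : 'M[F]_(m, d)) :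
  (forall w : 'rV_m, w *m B = 0 -> w = 0) -> row_free B.
Proof.
move=> B0; rewrite -kermx_eq0; apply/rowV0P => w /sub_kermxP; exact: B0.
Qed.

(** Real and imaginary parts of a complex frame of [L], completed by a frame
    of [E]: with real entries, smoothness and determinants stay over [R]. *)
Definition frame_mx {r} (s : 'I_r -> 'rV[R[i]]_(n + n)) (e1 e2 : 'rV[R]_(n + n)) :
    'M[R]_(r + r + (1 + 1), n + n) :=
  col_mx (col_mx (\matrix_i map_mx (@complex.Re R) (s i))
                 (\matrix_i map_mx (@complex.Im R) (s i)))
         (col_mx e1 e2).

Lemma mul_frame_mx {r} (s : 'I_r -> 'rV[R[i]]_(n + n)) (e1 e2 : 'rV[R]_(n + n))
    (a b : 'rV[R]_r) k l :
  row_mx (row_mx a b) (row_mx k%:M l%:M) *m frame_mx s e1 e2 =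
  map_mx (@complex.Re R) (cx a (- b) *m \matrix_i s i) + (k *: e1 + l *: e2).
Proof.
rewrite !mul_row_col !mul_scalar_mx; congr (_ + _).
rewrite -[\matrix_i s i]cx_ReIm cx_mulmx Re_cx mulNmx opprK.
by congr (_ + _); congr (_ *m _); apply/matrixP => i j; rewrite !mxE.
Qed.

Lemma free_frame {F : fieldType} {m r} (s : 'I_r -> 'rV[F]_m) :
  free [seq s i | i <- enum 'I_r] <-> row_free (\matrix_i s i).
Proof.
pose X := [tuple s i | i < r]; have -> : [seq s i | i <- enum 'I_r] = X by [].
have XE (i : 'I_r) : X`_i = s i by rewrite -tnth_nth tnth_mktuple.
have sumE (k : 'I_r -> F) : \sum_i k i *: X`_i = \row_i k i *m \matrix_i s i.
  by rewrite mulmx_sum_row; apply: eq_bigr => i _; rewrite mxE rowK XE.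
split=> [/freeP fX|fs].
  apply: row_free_inj0 => w w0; apply/rowP => i; rewrite mxE.
  apply: (fX (fun i => w 0 i)); rewrite sumE -[RHS]w0; congr (_ *m _).
  by apply/rowP => j; rewrite mxE.
apply/freeP => k; rewrite sumE => k0 i.
have /rowP/(_ i) : \row_i k i = 0 by apply: (row_free_inj fs); rewrite k0 mul0mx.
by rewrite !mxE.
Qed.

Lemma span_frame {F : fieldType} {m r} (s : 'I_r -> 'rV[F]_m) v :
  v \in <<[seq s i | i <- enum 'I_r]>>%VS <->
  exists w : 'rV_r, v = w *m \matrix_i s i.
Proof.
pose X := [tuple s i | i < r]; have -> : [seq s i | i <- enum 'I_r] = X by [].
have XE (i : 'I_r) : X`_i = s i by rewrite -tnth_nth tnth_mktuple.
split=> [/coord_span vX|[w ->]].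
  exists (\row_i coord X i v); rewrite {1}vX mulmx_sum_row.
  by apply: eq_bigr => i _; rewrite mxE rowK XE.
rewrite mulmx_sum_row memv_suml // => i _; rewrite rowK -XE memvZ // memv_span //.
by rewrite mem_nth // size_tuple.
Qed.

Lemma frame_mx_free {r} (s : 'I_r -> 'rV[R[i]]_(n + n)) (e1 e2 : 'rV[R]_(n + n)) :
  row_free (frame_mx s e1 e2) -> free [seq s i | i <- enum 'I_r].
Proof.
move=> fB; apply/free_frame/row_free_inj0 => w w0.
rewrite -(cx_ReIm w) in w0 *; set a := map_mx _ w in w0 *; set b := map_mx _ w in w0 *.
have := mul_frame_mx s e1 e2 a (- b) 0 0.
rewrite opprK w0 map_mx0 !scale0r !addr0 => B0.
have /eqP := row_free_inj fB (etrans B0 (esym (mul0mx _ _))).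
rewrite !row_mx_eq0 oppr_eq0 => /andP[/andP[/eqP-> /eqP->] _].
by rewrite cx0.
Qed.

Section FixedL.
Context {e1 e2 : 'rV[R]_(n + n)} {L : {vspace 'rV[R[i]]_(n + n)}}.
Hypothesis HL : fibre_gac e1 e2 L.

Let isoL : isotropic L. Proof. by case: (fibre_max HL). Qed.

Let orthL u v : cx u v \in L ->
  [/\ pairing u e1 = 0, pairing u e2 = 0, pairing v e1 = 0 & pairing v e2 = 0].
Proof.
move=> Luv; apply/complexified_orth_span2.
by have [_ + _] := fibre_max HL; apply.
Qed.

Lemma fibre_isotropic u v u' v' : cx u v \in L -> cx u' v' \in L ->
  pairing u u' = pairing v v' /\ pairing u v' = - pairing v u'.
Proof.
move=> Lz Lz'; have := isoL Lz Lz'.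
by rewrite pairing_cx => -[/subr0_eq -> /eqP]; rewrite addr_eq0 => /eqP->.
Qed.

(** A relation between the rows exhibits, once its [E]-part is removed by
    pairing with [e1] and [e2], an element of [L] with zero real part; its
    conjugate is its opposite, so it lies in [L] as well and vanishes. *)
Lemma fibre_frame_free {r} (s : 'I_r -> 'rV[R[i]]_(n + n)) :
  basis_of L [seq s i | i <- enum 'I_r] -> row_free (frame_mx s e1 e2).
Proof.
move=> bs; have fs : row_free (\matrix_i s i) by exact/free_frame/(basis_free bs).
have [e11 e22 e12] := fibre_pair HL.
apply: row_free_inj0 => w.
rewrite -[w]hsubmxK -[lsubmx w]hsubmxK -[rsubmx w]hsubmxK.
rewrite [lsubmx (rsubmx w)]mx11_scalar [rsubmx (rsubmx w)]mx11_scalar.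
set a := lsubmx (lsubmx w); set b := rsubmx (lsubmx w).
set k := lsubmx (rsubmx w) 0 0; set l := rsubmx (rsubmx w) 0 0.
rewrite mul_frame_mx; set z := _ *m _ => zkl.
have Lz : z \in L by rewrite -(span_basis bs); apply/span_frame; exists (cx a (- b)).
have [z1 z2 _ _] := orthL (etrans (congr1 (fun t => t \in L) (cx_ReIm z)) Lz).
have half0 : 2%:R^-1 != 0 :> R by rewrite invr_eq0 two_neq0.
have k0 : k = 0.
  have := congr1 (pairing ^~ e2) zkl; rewrite !pairingE_lin z2 e22 e12 mulr0 add0r addr0.
  by move/eqP; rewrite mulf_eq0 (negbTE half0) orbF => /eqP.
have l0 : l = 0.
  have := congr1 (pairing ^~ e1) zkl.
  rewrite !pairingE_lin z1 e11 (pairingC e2) e12 mulr0 !add0r.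
  by move/eqP; rewrite mulf_eq0 (negbTE half0) orbF => /eqP.
have Rez : map_mx (@complex.Re R) z = 0.
  by move: zkl; rewrite k0 l0 !scale0r !addr0.
have zE : z = cx 0 (map_mx (@complex.Im R) z) by rewrite -Rez cx_ReIm.
have z0 : z = 0.
  apply: (fibre_conj HL) => //; rewrite zE conj_cx.
  have -> : cx 0 (- map_mx (@complex.Im R) z) = - z.
    by rewrite {2}zE /cx map_mx0 map_mxN !add0r scalerN.
  by rewrite memvN.
have /(row_free_inj fs) : cx a (- b) *m \matrix_i s i = 0 *m \matrix_i s i.
  by rewrite mul0mx.
rewrite -cx0 => /cx_inj[-> /eqP]; rewrite oppr_eq0 => /eqP->.
by rewrite k0 l0 !raddf0 !row_mx0.
Qed.

(** The real frame above shows that [L] cannot be larger. If it were smaller,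
    the space [N] of vectors orthogonal to both [L] and [E] would have dimension
    at least two more than [L], hence contain a null vector outside [L], and
    adding this vector to [L] would contradict maximality. *)
Lemma fibre_corank : n = (\dim L).+1.
Proof.
set r := \dim L; pose s (i : 'I_r) := tnth (vbasis L) i.
have sE : [seq s i | i <- enum 'I_r] = vbasis L by exact: map_tnth_enum.
have bs : basis_of L [seq s i | i <- enum 'I_r] by rewrite sE vbasisP.
have le1 : (r + r + 2 <= n + n)%N.
  by have := fibre_frame_free bs; rewrite /row_free => /eqP {1}<-; apply: rank_leq_col.
pose c1 := map_mx (real_complex R) e1; pose c2 := map_mx (real_complex R) e2.
(* [N] is cut out by [r + 2] linear equations. *)
pose K := col_mx (\matrix_i s i) (col_mx c1 c2).
pose f : 'Hom('rV[R[i]]_(n + n), 'rV[R[i]]_(r + (1 + 1))) :=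
  linfun (mulmxr (gram *m K^T)).
pose N := lker f.
have dN : (n + n <= \dim N + (r + 2))%N.
  have := limg_ker_dim f fullv; rewrite capfv dimvf /dim /= mul1n -/N.
  have := dimvS (subvf (f @: fullv)%VS); rewrite dimvf /dim /= mul1n.
  by move: (\dim _) (\dim _) => p q pr <-; rewrite leq_add2l.
have le2 : (\dim N < r + 2)%N.
  rewrite ltnNge; apply/negP => leN.
  have : (1 < \dim (N :\: L))%N.
    have := dimv_cap_compl N L; have := dimvS (capvSr N L); rewrite -/r.
    move: (\dim _) (\dim _) => p q; lia.
  case/isotropic_vector => x [Dx x0 xx].
  have : x \in N by exact: (subvP (diffvSl _ _)) Dx.
  rewrite memv_ker lfunE /= mulmxA tr_col_mx tr_col_mx !mul_mx_row.
  rewrite !row_mx_eq0 => /and3P[/eqP xs /eqP x1 /eqP x2].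
  have xL l : l \in L -> pairing x l = 0.
    rewrite -(span_basis bs) => /span_frame[w ->].
    by rewrite pairingE trmx_mul mulmxA xs mul0mx mxE mulr0.
  have xc1 : pairing x c1 = 0 by rewrite pairingE x1 mxE mulr0.
  have xc2 : pairing x c2 = 0 by rewrite pairingE x2 mxE mulr0.
  have oW z : z \in (L + <[x]>)%VS ->
      complexified (orth <<[:: e1; e2]>>) z.
    have cE e : map_mx (real_complex R) e = cx e 0 by rewrite /cx map_mx0 scaler0 addr0.
    case/memv_addP => l Ll [_ /vlineP[k ->] ->].
    have lc e : e \in [:: e1; e2] -> pairing l (map_mx (real_complex R) e) = 0.
      rewrite !inE cE -[l]cx_ReIm pairing_cx !pairing0r.
      move: Ll; rewrite -{1}(cx_ReIm l) => /orthL[u1 u2 v1 v2].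
      by case/orP=> /eqP ->; rewrite ?u1 ?u2 ?v1 ?v2 subrr addr0.
    have zc e : e \in [:: e1; e2] ->
        pairing (l + k *: x) (map_mx (real_complex R) e) = 0.
      move=> ee; rewrite !pairingE_lin lc // add0r.
      by move: ee; rewrite !inE => /orP[]/eqP ->; rewrite ?xc1 ?xc2 mulr0.
    move: (l + k *: x) zc => {}z zc; rewrite -(cx_ReIm z).
    have z1 := zc e1 (mem_head _ _); have z2 := zc e2 (mem_last e1 [:: e2]).
    move: z1 z2; rewrite -{1 2}(cx_ReIm z) !cE !pairing_cx !pairing0r.
    rewrite !add0r !subr0 => -[z11 z12] [z21 z22].
    exact/complexified_orth_span2.
  have iW : isotropic (L + <[x]>)%VS.
    move=> _ _ /memv_addP[l Ll [_ /vlineP[k ->] ->]] /memv_addP[l' Ll' [_ /vlineP[k' ->] ->]].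
    by rewrite !pairingE_lin xx isoL // (pairingC l) !xL // !mulr0 !addr0.
  have [_ _ mL] := fibre_max HL.
  have LxL := mL _ iW oW (addvSl _ _).
  have Lx : x \in L by rewrite -LxL (subvP (addvSr _ _)) // memv_line.
  by case/eqP: x0; apply/eqP; rewrite -memv0 -(capv_diff N L) memv_cap Dx.
lia.
Qed.

Lemma fibre_frame_square r : r = \dim L -> (r + r + (1 + 1) = n + n)%N.
Proof. by move->; rewrite [in RHS]fibre_corank; lia. Qed.

(** By the dimension count, the real vectors orthogonal to [E] are the real
    parts of the elements of [L]; claims about the real fibre thus reduce to
    [L], where [Phi] is multiplication by [i], and to [E], where it is zero. *)
Lemma fibre_decomp x :
  exists z k l, z \in L /\ x = map_mx (@complex.Re R) z + (k *: e1 + l *: e2).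
Proof.
set r := \dim L; pose s (i : 'I_r) := tnth (vbasis L) i.
have sE : [seq s i | i <- enum 'I_r] = vbasis L by exact: map_tnth_enum.
have bs : basis_of L [seq s i | i <- enum 'I_r] by rewrite sE vbasisP.
have : row_full (frame_mx s e1 e2).
  have := fibre_frame_free bs; rewrite /row_free /row_full => /eqP->.
  by rewrite fibre_frame_square.
case/row_fullP => Q QB; have {}QB := congr1 (mulmx x) QB; move: QB.
rewrite mulmx1 mulmxA; move: (x *m Q) => w <-.
rewrite -[w]hsubmxK -[lsubmx w]hsubmxK -[rsubmx w]hsubmxK.
rewrite [lsubmx (rsubmx w)]mx11_scalar [rsubmx (rsubmx w)]mx11_scalar mul_frame_mx.
do 3!eexists; split; last by [].
by rewrite -(span_basis bs); apply/span_frame; eexists.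
Qed.

End FixedL.
End Fibre.

(** * The endomorphism attached to a fibre *)

Section FibreEndo.
Context {R : realType} {n : nat}.
Implicit Types (x y : 'rV[R]_(n + n)) (Phi : 'M[R]_(n + n)).
Implicit Types (L W : {vspace 'rV[R[i]]_(n + n)}) (z : 'rV[R[i]]_(n + n)).

Definition ieigen Phi : {vspace 'rV[R[i]]_(n + n)} :=
  lker (linfun (mulmxr (map_mx (real_complex R) Phi - 'i%C%:M))).

Lemma ieigenP Phi z :
  z \in ieigen Phi <-> z *m map_mx (real_complex R) Phi = 'i%C *: z.
Proof.
rewrite memv_ker lfunE /= mulmxBr mul_mx_scalar subr_eq0.
by split=> [/eqP|->].
Qed.

(** The defining property of [Phi]: it determines the real matrix [Phi] because
    [L], its conjugate and [E] span. *)
Definition fibre_endo Phi (e1 e2 : 'rV[R]_(n + n)) L : Prop :=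
  [/\ forall z, z \in L -> z *m map_mx (real_complex R) Phi = 'i%C *: z,
      e1 *m Phi = 0 & e2 *m Phi = 0].

Record fibre_triple Phi (e1 e2 : 'rV[R]_(n + n)) : Prop := FibreTriple {
  ft_pair : isotropic_pair e1 e2;
  ft_skew : forall x y, pairing (x *m Phi) y = - pairing x (y *m Phi);
  ft_e1 : e1 *m Phi = 0;
  ft_e2 : e2 *m Phi = 0;
  ft_sq : forall x, x *m Phi *m Phi =
    - x + (2%:R * pairing x e1) *: e2 + (2%:R * pairing x e2) *: e1
}.

(** Multiplication by [i] on [L] and by [0] on [E], in terms of the real frame
    [frame_mx s e1 e2]. *)
Definition rotated_frame_mx {r} (s : 'I_r -> 'rV[R[i]]_(n + n)) :
    'M[R]_(r + r + (1 + 1), n + n) :=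
  col_mx (col_mx (- \matrix_i map_mx (@complex.Im R) (s i))
                 (\matrix_i map_mx (@complex.Re R) (s i))) 0.

Lemma frame_mx_endo {r} (s : 'I_r -> 'rV[R[i]]_(n + n)) Phi (e1 e2 : 'rV[R]_(n + n)) :
  frame_mx s e1 e2 *m Phi = rotated_frame_mx s <->
  fibre_endo Phi e1 e2 <<[seq s i | i <- enum 'I_r]>>.
Proof.
have PE : \matrix_i map_mx (@complex.Re R) (s i) = map_mx (@complex.Re R) (\matrix_i s i).
  by apply/matrixP => i j; rewrite !mxE.
have QE : \matrix_i map_mx (@complex.Im R) (s i) = map_mx (@complex.Im R) (\matrix_i s i).
  by apply/matrixP => i j; rewrite !mxE.
rewrite /frame_mx /rotated_frame_mx PE QE; set P := map_mx _ _; set Q := map_mx _ _.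
have SE : \matrix_i s i = cx P Q by rewrite cx_ReIm.
rewrite !mul_col_mx; split=> [E|[sP e1P e2P]]; last first.
  have E : cx (P *m Phi) (Q *m Phi) = cx (- Q) P.
    rewrite -cx_mulmx_real -cx_scale_i -SE; apply/row_matrixP => i.
    rewrite row_mul rowK sP; first by rewrite [RHS]linearZ /= rowK.
    by apply/memv_span/map_f; rewrite mem_enum.
  by have [-> ->] := cx_inj E; rewrite e1P e2P col_mx0.
have [/eq_col_mx[PP QP] E2] := eq_col_mx E.
move: E2; rewrite -col_mx0 => /eq_col_mx[e1P e2P]; split=> // z.
case/span_frame => w ->; rewrite -mulmxA SE cx_mulmx_real PP QP -cx_scale_i.
by rewrite -scalemxAr.
Qed.

Section Determined.
Context {e1 e2 : 'rV[R]_(n + n)} {L : {vspace 'rV[R[i]]_(n + n)}}.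
Hypothesis HL : fibre_gac e1 e2 L.

Let r := \dim L.
Let s (i : 'I_r) := tnth (vbasis L) i.

Lemma fibre_endo_exists : exists Phi, fibre_endo Phi e1 e2 L.
Proof.
have sE : [seq s i | i <- enum 'I_r] = vbasis L by exact: map_tnth_enum.
have bs : basis_of L [seq s i | i <- enum 'I_r] by rewrite sE vbasisP.
have : row_free (frame_mx s e1 e2) by exact: fibre_frame_free bs.
case/row_freeP => Q BQ; exists (Q *m rotated_frame_mx s).
rewrite -(span_basis bs); apply/frame_mx_endo.
by rewrite mulmxA BQ mul1mx.
Qed.

Lemma fibre_decomp_cx x : exists u v k l,
  cx u v \in L /\ x = u + (k *: e1 + l *: e2).
Proof.
have [z [k [l [Lz ->]]]] := fibre_decomp HL x.
by exists (map_mx (@complex.Re R) z), (map_mx (@complex.Im R) z), k, l; rewrite cx_ReIm.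
Qed.

Lemma fibre_endo_uniq Phi Phi' :
  fibre_endo Phi e1 e2 L -> fibre_endo Phi' e1 e2 L -> Phi = Phi'.
Proof.
move=> [LP e1P e2P] [LP' e1P' e2P']; apply/row_matrixP => i; rewrite !rowE.
have [u [v [k [l [Luv ->]]]]] := fibre_decomp_cx (delta_mx 0 i).
have [uP _] := (eigen_cx _ _ _).1 (LP _ Luv).
have [uP' _] := (eigen_cx _ _ _).1 (LP' _ Luv).
by rewrite !mulmxDl -!scalemxAl uP uP' e1P e2P e1P' e2P'.
Qed.

(** If [x] has [L]-part [u + i v], then [x Phi = - v]. Skew-symmetry is then
    the vanishing of the imaginary part of the pairing on [L]. *)
Lemma fibre_endo_triple Phi : fibre_endo Phi e1 e2 L -> fibre_triple Phi e1 e2.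
Proof.
move=> [LP e1P e2P]; have [e11 e22 e12] := fibre_pair HL.
have mulP u v k l : cx u v \in L ->
    (u + (k *: e1 + l *: e2)) *m Phi = - v /\ v *m Phi = u.
  move=> Luv; have [uP vP] := (eigen_cx _ _ _).1 (LP _ Luv).
  by rewrite !mulmxDl -!scalemxAl uP e1P e2P !scaler0 !addr0.
have orthL u v : cx u v \in L ->
  [/\ pairing u e1 = 0, pairing u e2 = 0, pairing v e1 = 0 & pairing v e2 = 0].
  move=> Luv; apply/complexified_orth_span2.
  by have [_ + _] := fibre_max HL; apply.
split=> // [x y|x].
  have [u [v [k [l [Luv ->]]]]] := fibre_decomp_cx x.
  have [u' [v' [k' [l' [Luv' ->]]]]] := fibre_decomp_cx y.
  have [-> _] := mulP _ _ k l Luv; have [-> _] := mulP _ _ k' l' Luv'.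
  have [u1 u2 v1 v2] := orthL _ _ Luv; have [u1' u2' v1' v2'] := orthL _ _ Luv'.
  have [_ uv] := fibre_isotropic HL Luv Luv'.
  rewrite !pairingE_lin v1 v2 (pairingC e1) (pairingC e2) v1' v2' uv.
  by rewrite !oppr0 !mulr0 !addr0 opprK.
have [u [v [k [l [Luv ->]]]]] := fibre_decomp_cx x.
have [-> vP] := mulP _ _ k l Luv; have [u1 u2 v1 v2] := orthL _ _ Luv.
rewrite mulNmx vP !pairingE_lin u1 u2 e11 e22 e12 (pairingC e2) e12.
rewrite !mulr0 !add0r !addr0 mulrCA mulfV ?two_neq0 // mulr1 mulrCA mulfV ?two_neq0 //.
by rewrite mulr1 !opprD !addrA addrNK addrNK.
Qed.

End Determined.

Section Eigenspace.
Context {Phi : 'M[R]_(n + n)} {e1 e2 : 'rV[R]_(n + n)}.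
Hypothesis HP : fibre_triple Phi e1 e2.
Local Notation PhiC := (map_mx (real_complex R) Phi).

Let skewC z w : pairing (z *m PhiC) w = - pairing z (w *m PhiC).
Proof.
rewrite -(cx_ReIm z) -(cx_ReIm w) !cx_mulmx_real !pairing_cx !(ft_skew HP).
by apply/eqP; rewrite eq_complex /= !opprD !eqxx.
Qed.

Let cube x : x *m Phi *m Phi *m Phi = - (x *m Phi).
Proof.
rewrite (ft_sq HP x) !mulmxDl -!scalemxAl (ft_e1 HP) (ft_e2 HP) !scaler0 !addr0.
exact: mulNmx.
Qed.

(** Since the cube of [Phi] is [- Phi], this vector is the image of [z] under
    minus twice the projection onto the eigenspace. *)
Lemma ieigen_proj z : z *m PhiC *m PhiC + 'i%C *: (z *m PhiC) \in ieigen Phi.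
Proof.
have cubeC : z *m PhiC *m PhiC *m PhiC = - (z *m PhiC).
  rewrite -(cx_ReIm z) !cx_mulmx_real !cube /cx !map_mxN scalerN.
  by rewrite [RHS]opprD.
apply/ieigenP; rewrite mulmxDl cubeC -scalemxAl scalerDr scale_i_i addrC.
by [].
Qed.

Let isoE : isotropic (ieigen Phi).
Proof.
move=> z w /ieigenP zP /ieigenP wP; have := skewC z w.
rewrite zP wP !pairingE_lin => /eqP; rewrite -subr_eq0 opprK -mulr2n -mulrnAr.
rewrite mulf_eq0 -mulr_natl mulf_eq0 (negbTE ctwo_neq0) /= => /orP[|/eqP //].
by rewrite eq_complex /= oner_eq0 andbF.
Qed.

Lemma ieigen_orth z : z \in ieigen Phi ->
  complexified (orth <<[:: e1; e2]>>) z.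
Proof.
move=> /ieigenP; rewrite -(cx_ReIm z); set u := map_mx _ z; set v := map_mx _ z.
move=> /eigen_cx[uP vP]; apply/complexified_orth_span2.
have ort x e : e *m Phi = 0 -> pairing (x *m Phi) e = 0.
  by move=> eP; rewrite (ft_skew HP) eP pairing0r oppr0.
have vN : v = - (u *m Phi) by rewrite uP opprK.
by rewrite vN -vP !pairingNl !ort ?oppr0 ?(ft_e1 HP) ?(ft_e2 HP).
Qed.

Lemma orth_sq z : complexified (orth <<[:: e1; e2]>>) z ->
  z *m PhiC *m PhiC = - z.
Proof.
rewrite -(cx_ReIm z); set u := map_mx _ z; set v := map_mx _ z.
move=> /complexified_orth_span2[u1 u2 v1 v2]; rewrite !cx_mulmx_real !(ft_sq HP).
rewrite u1 u2 v1 v2 !mulr0 !scale0r !addr0 /cx !map_mxN scalerN.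
by rewrite [RHS]opprD.
Qed.

(** Maximality: an element [w] of a larger isotropic space has a component [u]
    in the conjugate eigenspace, which still lies in that space; [u] is then
    orthogonal to the eigenspace, and by skew-symmetry to everything. *)
Lemma fibre_triple_gac : fibre_gac e1 e2 (ieigen Phi).
Proof.
split; first exact: ft_pair HP.
- split; [exact: isoE|exact: ieigen_orth|].
  move=> W isoW orthW EW; apply/eqP; rewrite eqEsubv EW andbT; apply/subvP => w Ww.
  have w2 := orth_sq (orthW _ Ww).
  have Ew := ieigen_proj w; rewrite w2 in Ew.
  (* Twice the component of [w] in the conjugate eigenspace. *)
  pose u := w + 'i%C *: (w *m PhiC).
  have Wu : u \in W.
    have -> : u = w + w + (- w + 'i%C *: (w *m PhiC)) by rewrite addrA addrK.
    by apply: memvD; [exact: memvD|exact: (subvP EW)].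
  have uP : u *m PhiC = - ('i%C *: u).
    by rewrite /u mulmxDl -scalemxAl w2 scalerN scalerDr scale_i_i opprD opprK addrC.
  have u0 : u = 0.
    apply: pairing_nondegenerate ctwo_neq0 _ => y.
    have uyP t : pairing u (t *m PhiC) = 'i%C * pairing u t.
      by apply: oppr_inj; rewrite -skewC uP pairingNl pairingZl.
    have := isoW _ _ Wu (subvP EW _ (ieigen_proj y)).
    rewrite pairingDr pairingZr !uyP mulrA -expr2 sqr_i mulN1r => /eqP.
    rewrite -opprD oppr_eq0 -mulr2n -mulr_natl mulf_eq0 (negbTE ctwo_neq0).
    by move/eqP.
  apply/ieigenP/esym/subr0_eq.
  by rewrite -scale_i_i -scalerDr -/u u0 scaler0.
- move=> z /ieigenP + /ieigenP; rewrite -(cx_ReIm z).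
  move: (map_mx _ z) (map_mx _ z) => v u; rewrite conj_cx.
  move=> /eigen_cx[uP vP] /eigen_cx[uP' _].
  have v0 : v = 0.
    have : v + v = 0 by rewrite -{1}(opprK v) -uP' uP addNr.
    move/eqP; rewrite -mulr2n -scaler_nat scaler_eq0 (negbTE two_neq0).
    by move/eqP.
  by rewrite -vP v0 mul0mx cx0.
Qed.

End Eigenspace.

(** The eigenspace is isotropic and contains [L], which is maximal. *)
Lemma fibre_endo_eigen Phi (e1 e2 : 'rV[R]_(n + n)) L :
  fibre_gac e1 e2 L -> fibre_endo Phi e1 e2 L -> L = ieigen Phi.
Proof.
move=> HL EP; have HP := fibre_endo_triple HL EP.
have [_ _ mL] := fibre_max HL; apply/esym/mL.
- by have [] := fibre_max (fibre_triple_gac HP).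
- exact: ieigen_orth HP.
- by have [LP _ _] := EP; apply/subvP => z /LP/ieigenP.
Qed.

End FibreEndo.

(** * Endomorphisms of a fibre of the cone bundle *)

Section Cone.
Context {R : realType} {n : nat}.
Implicit Types (x y : 'rV[R]_(n + n)) (f g : R).
Implicit Types (J : 'M[R]_(n + n + (1 + 1))) (v w : 'rV[R]_(n + n + (1 + 1))).

Lemma evec_surj w : exists x f g, w = evec x f g.
Proof.
exists (lsubmx w), (edt_vec w), (edt_form w); rewrite /evec /edt_vec /edt_form.
by rewrite -!mx11_scalar !hsubmxK.
Qed.

Lemma ebase_evec x f g : ebase (evec x f g) = x.
Proof. exact: row_mxKl. Qed.

Lemma edt_vec_evec x f g : edt_vec (evec x f g) = f.
Proof. by rewrite /edt_vec /evec row_mxKr row_mxKl mxE eqxx mulr1n. Qed.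

Lemma edt_form_evec x f g : edt_form (evec x f g) = g.
Proof. by rewrite /edt_form /evec row_mxKr row_mxKr mxE eqxx mulr1n. Qed.

Lemma evec_inj x y f g h k : evec x f g = evec y h k -> [/\ x = y, f = h & g = k].
Proof.
move=> E; split.
- by rewrite -(ebase_evec x f g) E ebase_evec.
- by rewrite -(edt_vec_evec x f g) E edt_vec_evec.
- by rewrite -(edt_form_evec x f g) E edt_form_evec.
Qed.

Lemma evecD x y f g h k : evec x f g + evec y h k = evec (x + y) (f + h) (g + k).
Proof. by rewrite /evec !add_row_mx -!raddfD. Qed.

Lemma evecZ a x f g : a *: evec x f g = evec (a *: x) (a * f) (a * g).
Proof. by rewrite /evec !scale_row_mx !scale_scalar_mx. Qed.

Lemma evecN x f g : - evec x f g = evec (- x) (- f) (- g).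
Proof. by rewrite -scaleN1r evecZ scaleN1r !mulN1r. Qed.

Lemma evec_split x f g :
  evec x f g = evec x 0 0 + (f *: evec 0 1 0 + g *: evec 0 0 1).
Proof. by rewrite !evecZ !evecD !scaler0 !mulr0 !mulr1 !(add0r, addr0). Qed.

Lemma epairing_evec x y f g h k :
  epairing (evec x f g) (evec y h k) = pairing x y + 2%:R^-1 * (f * k + h * g).
Proof. by rewrite /epairing !ebase_evec !edt_vec_evec !edt_form_evec. Qed.

(** The endomorphism of the fibre of the cone bundle with given triple; its
    last two columns are forced by skew-symmetry. *)
Definition cone_endo (Phi : 'M[R]_(n + n)) (e1 e2 : 'rV[R]_(n + n)) :
    'M[R]_(n + n + (1 + 1)) :=
  block_mx Phi (- (gram *m (col_mx e2 e1)^T)) (col_mx e1 e2) 0.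

Lemma mul_gram_tr x e : x *m gram *m e^T = (2%:R * pairing x e)%:M.
Proof. by rewrite pairingE mulrA mulfV ?two_neq0 // mul1r -mx11_scalar. Qed.

Lemma evec_cone_endo Phi (e1 e2 : 'rV[R]_(n + n)) x f g :
  evec x f g *m cone_endo Phi e1 e2 =
  evec (x *m Phi + (f *: e1 + g *: e2)) (- (2%:R * pairing x e2))
       (- (2%:R * pairing x e1)).
Proof.
rewrite /evec mul_row_block mulmx0 addr0 mul_row_col !mul_scalar_mx.
rewrite tr_col_mx mul_mx_row mulmxN mul_mx_row !mulmxA !mul_gram_tr.
by rewrite opp_row_mx -!raddfN.
Qed.

Definition skew_endo J := forall v w, epairing (v *m J) w = - epairing v (w *m J).

Definition vertical_to_base J :=
  forall f g, exists x, evec 0 f g *m J = evec x 0 0.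

(** The components of [triple_of], for the value of [J] at one point. *)
Definition endo_Phi J : 'M[R]_(n + n) := \matrix_i ebase (evec (delta_mx 0 i) 0 0 *m J).
Definition endo_e1 J : 'rV[R]_(n + n) := ebase (evec 0 1 0 *m J).
Definition endo_e2 J : 'rV[R]_(n + n) := ebase (evec 0 0 1 *m J).

Lemma endo_PhiE J : endo_Phi J = ulsubmx J.
Proof.
apply/row_matrixP => i; rewrite rowK rowE -{1}(submxK J) /evec.
rewrite !raddf0 row_mx0 mul_row_block !mul0mx !addr0.
exact: row_mxKl.
Qed.

Lemma endo_e1E J : endo_e1 J = row_mx 1%:M 0 *m dlsubmx J.
Proof.
rewrite /endo_e1 -{1}(submxK J) /evec raddf0 mul_row_block !mul0mx !add0r.
exact: row_mxKl.
Qed.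

Lemma endo_e2E J : endo_e2 J = row_mx 0 1%:M *m dlsubmx J.
Proof.
rewrite /endo_e2 -{1}(submxK J) /evec raddf0 mul_row_block !mul0mx !add0r.
exact: row_mxKl.
Qed.

Lemma ebase_mul J x : ebase (evec x 0 0 *m J) = x *m endo_Phi J.
Proof.
rewrite endo_PhiE -{1}(submxK J) /evec !raddf0 row_mx0 mul_row_block !mul0mx !addr0.
exact: row_mxKl.
Qed.

(** The components of [x J] along the vertical directions are read off by
    pairing with these directions and using skew-symmetry. *)
Lemma endo_evec J x : skew_endo J -> vertical_to_base J ->
  [/\ evec 0 1 0 *m J = evec (endo_e1 J) 0 0,
      evec 0 0 1 *m J = evec (endo_e2 J) 0 0
    & evec x 0 0 *m J = evec (x *m endo_Phi J) (- (2%:R * pairing x (endo_e2 J)))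
                             (- (2%:R * pairing x (endo_e1 J)))].
Proof.
move=> sJ vJ.
have E1 : evec 0 1 0 *m J = evec (endo_e1 J) 0 0.
  by have [y yE] := vJ 1 0; rewrite /endo_e1 yE ebase_evec.
have E2 : evec 0 0 1 *m J = evec (endo_e2 J) 0 0.
  by have [y yE] := vJ 0 1; rewrite /endo_e2 yE ebase_evec.
split=> //; have [y [f [g yE]]] := evec_surj (evec x 0 0 *m J).
have := sJ (evec x 0 0) (evec 0 1 0); have := sJ (evec x 0 0) (evec 0 0 1).
have := ebase_mul J x.
rewrite E1 E2 yE ebase_evec !epairing_evec !pairing0r => ->.
rewrite !(mulr0, mul0r, mulr1, mul1r, addr0, add0r) => Ef Eg.
congr (evec _ _ _).
  by rewrite -mulrN -Ef mulrA mulfV ?two_neq0 // mul1r.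
by rewrite -mulrN -Eg mulrA mulfV ?two_neq0 // mul1r.
Qed.

(** All the equations of a triple are components of [J ^ 2 = - 1], applied to
    the vertical directions and to the base, except skew-symmetry of [Phi]. *)
Lemma cone_endo_triple J : J *m J = - 1%:M -> skew_endo J -> vertical_to_base J ->
  fibre_triple (endo_Phi J) (endo_e1 J) (endo_e2 J).
Proof.
move=> J2 sJ vJ; have JE x := endo_evec x sJ vJ.
have JJ w : w *m J *m J = - w by rewrite -mulmxA J2 mulmxN mulmx1.
have inv2 (a : R) : - (2%:R * a) = - 1 -> a = 2%:R^-1.
  by move/oppr_inj => E; rewrite -[LHS](mulKf two_neq0) E mulr1.
have inv0 (a : R) : - (2%:R * a) = 0 -> a = 0.
  by move/eqP; rewrite oppr_eq0 mulf_eq0 (negbTE two_neq0) => /eqP.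
have /= E1 := JJ (evec 0 1 0); have /= E2 := JJ (evec 0 0 1).
have [J1 _ J1'] := JE (endo_e1 J); have [_ J2e J2'] := JE (endo_e2 J).
rewrite J1 J1' evecN oppr0 in E1; rewrite J2e J2' evecN oppr0 in E2.
have [e1P e12 e11] := evec_inj E1; have [e2P e22 _] := evec_inj E2.
rewrite oppr0 in e11 e22.
split=> // [|x y|x].
- split; [exact: inv0|exact: inv0|exact: inv2].
- have := sJ (evec x 0 0) (evec y 0 0).
  have [_ _ ->] := JE x; have [_ _ ->] := JE y; rewrite !epairing_evec.
  by rewrite !(mulr0, mul0r, addr0).
- have := JJ (evec x 0 0); have [_ _ ->] := JE x.
  rewrite evec_split !mulmxDl -!scalemxAl.
  have [-> -> ->] := JE (x *m endo_Phi J).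
  rewrite !evecZ !evecD evecN => /evec_inj[+ _ _].
  rewrite !scaleNr addrC -!opprD => /eqP; rewrite addrC subr_eq => /eqP->.
  by rewrite -addrA; congr (_ + _); rewrite addrC.
Qed.

Section OfTriple.
Context {Phi : 'M[R]_(n + n)} {e1 e2 : 'rV[R]_(n + n)}.
Hypothesis HP : fibre_triple Phi e1 e2.

Lemma cone_endo_sq : cone_endo Phi e1 e2 *m cone_endo Phi e1 e2 = - 1%:M.
Proof.
apply/row_matrixP => i; rewrite !rowE mulmxN mulmx1 mulmxA.
have [x [f [g ->]]] := evec_surj (delta_mx 0 i).
have [e11 e22 e12] := ft_pair HP.
rewrite !evec_cone_endo evecN !mulmxDl -!scalemxAl (ft_e1 HP) (ft_e2 HP).
rewrite (ft_sq HP) !pairingE_lin !(ft_skew HP) (ft_e1 HP) (ft_e2 HP).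
rewrite e11 e22 (pairingC e2 e1) e12 !pairing0r !(scaler0, oppr0, mulr0, addr0, add0r).
have half (a : R) : 2%:R * (a * 2%:R^-1) = a by rewrite mulrCA mulfV ?two_neq0 ?mulr1.
rewrite !half; congr (evec _ _ _).
by rewrite !scaleNr -opprD -[X in X - _]addrA (addrC (_ *: e2)) addrK.
Qed.

Lemma cone_endo_skew : skew_endo (cone_endo Phi e1 e2).
Proof.
move=> v w; have [x [f [g ->]]] := evec_surj v; have [y [h [k ->]]] := evec_surj w.
rewrite !evec_cone_endo !epairing_evec !pairingE_lin (ft_skew HP).
rewrite (pairingC e1) (pairingC e2).
have two := two_neq0 (R := R).
by field.
Qed.

Lemma cone_endo_vertical : vertical_to_base (cone_endo Phi e1 e2).
Proof.
move=> f g; exists (f *: e1 + g *: e2).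
by rewrite evec_cone_endo mul0mx add0r !pairing0l mulr0 oppr0.
Qed.

End OfTriple.

Lemma endo_cone_endo (Phi : 'M[R]_(n + n)) (e1 e2 : 'rV[R]_(n + n)) :
  [/\ endo_Phi (cone_endo Phi e1 e2) = Phi, endo_e1 (cone_endo Phi e1 e2) = e1
    & endo_e2 (cone_endo Phi e1 e2) = e2].
Proof.
split.
- by rewrite endo_PhiE block_mxKul.
- by rewrite /endo_e1 evec_cone_endo ebase_evec mul0mx scale1r scale0r addr0 add0r.
- by rewrite /endo_e2 evec_cone_endo ebase_evec mul0mx scale1r scale0r !add0r.
Qed.

End Cone.

(** * Smooth fields in charts *)

Section SmoothFields.
Context {R : realType} {n : nat} {M : smooth_manifold R n}.
Implicit Types (c : chart R n M) (p q : M) (V W : set M).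

Definition smooth_mx_section {a} V (A : M -> 'M[R]_(a, n + n)) : Prop :=
  smooth_in_charts V (fun c p => A p *m gframe c p).

Lemma smooth_in_charts_sub {a b} V W (F : chart R n M -> M -> 'M[R]_(a, b)) :
  W `<=` V -> smooth_in_charts V F -> smooth_in_charts W F.
Proof.
move=> WV sF c ac; apply: smooth_on_sub (sF c ac) => _ [p [cp Wp] <-].
by exists p => //; split=> //; apply: WV.
Qed.

Lemma smooth_mx_section_lmul {a b} V (K : 'M[R]_(b, a)) (A : M -> 'M[R]_(a, n + n)) :
  open V -> smooth_mx_section V A -> smooth_mx_section V (fun p => K *m A p).
Proof.
move=> oV sA c ac; have oU := open_chart_image (c := c) oV.
apply: (smooth_on_ext oU _ (smooth_on_mulmx oU (smooth_on_cst _ K) (sA c ac))).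
by move=> y _ /=; rewrite mulmxA.
Qed.

Lemma smooth_mx_sectionD {a} V (A B : M -> 'M[R]_(a, n + n)) : open V ->
  smooth_mx_section V A -> smooth_mx_section V B ->
  smooth_mx_section V (fun p => A p + B p).
Proof.
move=> oV sA sB c ac; have oU := open_chart_image (c := c) oV.
apply: (smooth_on_ext oU _ (smooth_onD oU (sA c ac) (sB c ac))).
by move=> y _ /=; rewrite mulmxDl.
Qed.

Lemma smooth_mx_sectionN {a} V (A : M -> 'M[R]_(a, n + n)) : open V ->
  smooth_mx_section V A -> smooth_mx_section V (fun p => - A p).
Proof.
move=> oV sA; have := smooth_mx_section_lmul (- 1%:M) oV sA.
by under [X in smooth_mx_section V X]funext => p do rewrite mulNmx mul1mx.
Qed.

Lemma smooth_mx_section_cst0 {a} V : open V ->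
  smooth_mx_section V (fun _ : M => 0 : 'M[R]_(a, n + n)).
Proof.
move=> oV c ac; have oU := open_chart_image (c := c) oV.
apply: (smooth_on_ext oU _ (smooth_on_cst _ 0)).
by move=> y _ /=; rewrite mul0mx.
Qed.

Lemma smooth_mx_section_endo {a} V (A : M -> 'M[R]_(a, n + n)) (Phi : M -> 'M[R]_(n + n)) :
  open V -> smooth_mx_section V A -> smooth_morphism Phi ->
  smooth_mx_section V (fun p => A p *m Phi p).
Proof.
move=> oV sA sP c ac; have oU := open_chart_image (c := c) oV.
have sPV := smooth_in_charts_sub (@subsetT _ V) sP ac.
apply: (smooth_on_ext oU _ (smooth_on_mulmx oU (sA c ac) sPV)).
move=> _ [p [cp Vp] <-] /=; rewrite (chart_mapK cp) !mulmxA.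
by rewrite (mulmxK (gframe_unit ac cp)).
Qed.

Lemma smooth_mx_section_rows {a} V (f : 'I_a -> M -> 'rV[R]_(n + n)) : open V ->
  (forall i, smooth_section V (f i)) ->
  smooth_mx_section V (fun p => \matrix_i f i p).
Proof.
move=> oV sf c ac; have oU := open_chart_image (c := c) oV.
apply/smooth_on_mxP => // i j; have /smooth_on_mxP/(_ 0 j) := sf i c ac.
move=> /(_ oU); apply: smooth_on_ext => // y _ /=.
by rewrite [LHS]mxE [RHS]mxE; apply: eq_bigr => k _; rewrite [in RHS]mxE.
Qed.

Lemma smooth_mx_section_col {a b} V (A : M -> 'M[R]_(a, n + n)) (B : M -> 'M[R]_(b, n + n)) :
  open V -> smooth_mx_section V A -> smooth_mx_section V B ->
  smooth_mx_section V (fun p => col_mx (A p) (B p)).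
Proof.
move=> oV sA sB c ac; have oU := open_chart_image (c := c) oV.
apply: (smooth_on_ext oU _ (smooth_on_col_mx oU (sA c ac) (sB c ac))).
by move=> y _ /=; rewrite mul_col_mx.
Qed.

Lemma smooth_frame_mx {r} V (s : 'I_r -> M -> 'rV[R[i]]_(n + n)) e e' : open V ->
  (forall i, smooth_csection V (s i)) -> smooth_section V e -> smooth_section V e' ->
  smooth_mx_section V (fun p => frame_mx (s^~ p) (e p) (e' p)) /\
  smooth_mx_section V (fun p => rotated_frame_mx (s^~ p)).
Proof.
move=> oV ss se se'.
have sRe : smooth_mx_section V (fun p => \matrix_i map_mx (@complex.Re R) (s i p)).
  by apply: smooth_mx_section_rows => // i; have [] := ss i.
have sIm : smooth_mx_section V (fun p => \matrix_i map_mx (@complex.Im R) (s i p)).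
  by apply: smooth_mx_section_rows => // i; have [] := ss i.
split; apply: smooth_mx_section_col => //; try apply: smooth_mx_section_col => //.
- exact: smooth_mx_sectionN.
- exact: smooth_mx_section_cst0.
Qed.

(** In a chart, the matrix of [Phi] solves a linear system whose coefficients
    are the coordinates of a frame and of its image. *)
Lemma smooth_morphism_frame (Phi : M -> 'M[R]_(n + n)) :
  (forall p, exists m V (B C : M -> 'M[R]_(m, n + n)),
    [/\ m = (n + n)%N, open V, V p, smooth_mx_section V B /\ smooth_mx_section V C
      & forall q, V q -> row_free (B q) /\ B q *m Phi q = C q]) ->
  smooth_morphism Phi.
Proof.
move=> loc c ac; apply: smooth_on_bigcup => _ [p [cp _] <-].
have [m [V [B [C [mE oV Vp [sB sC] BC]]]]] := loc p.
have oU := open_chart_image (c := c) oV.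
exists (c @` (chart_dom c `&` V)); first by exists p.
apply: (smooth_on_solve mE oU _ _ (sB c ac) (sC c ac)).
  move=> _ [q [cq Vq] <-] /=; rewrite (chart_mapK cq).
  have [fB _] := BC q Vq.
  by rewrite /row_free mxrankMfree // row_free_unit (gframe_unit ac cq).
move=> _ [q [cq Vq] <-] /=; rewrite (chart_mapK cq) !mulmxA.
by rewrite (mulmxK (gframe_unit ac cq)); have [_ ->] := BC q Vq.
Qed.

(** In a chart the rows become continuous, and so does their determinant. *)
Lemma near_row_free {m} V p (B : M -> 'M[R]_(m, n + n)) : m = (n + n)%N ->
  open V -> V p -> smooth_mx_section V B -> row_free (B p) ->
  \forall q \near p, row_free (B q).
Proof.
move=> mE oV Vp sB fB; subst m.
pose c := chart_at p; have [ac cp] := (chart_at_atlas p, chart_at_dom p).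
have oU := open_chart_image (c := c) oV.
have sd := smooth_on_det oU (sB c ac).
have cd : {for c p, continuous (fun y =>
    \det (((fun q => B q *m gframe c q) \o chart_inv c) y))}.
  by apply: smooth_on_continuous sd _; exists p.
have d0 : \det (((fun q => B q *m gframe c q) \o chart_inv c) (c p)) != 0.
  rewrite /= (chart_mapK cp) det_mulmx mulf_neq0 // -unitfE -unitmxE.
    by rewrite -row_free_unit.
  exact: gframe_unit.
have n0 : \forall y \near c p,
    \det (((fun q => B q *m gframe c q) \o chart_inv c) y) != 0.
  by apply: (cd [set x : R | x != 0]); apply: open_nbhs_nbhs; split; [apply: open_neq|].
have cc := chart_continuous cp.
have nc : \forall q \near p,
  \det (((fun q => B q *m gframe c q) \o chart_inv c) (c q)) != 0 := cc _ n0.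
have nd : nbhs p (chart_dom c) by exact: open_nbhs_nbhs (conj (@chart_dom_open _ _ _ c) cp).
suff H : chart_dom c `&` [set q |
    \det (((fun q => B q *m gframe c q) \o chart_inv c) (c q)) != 0]
    `<=` [set q | row_free (B q)].
  exact: filterS H (filterI nd nc).
move=> q [cq].
rewrite /= (chart_mapK cq) det_mulmx mulf_eq0 negb_or.
by case/andP=> + _; rewrite -unitfE -unitmxE row_free_unit.
Qed.

End SmoothFields.

(** * Triples as fields on the cone *)

Section ConeFields.
Context {R : realType} {n : nat} {M : smooth_manifold R n}.
Implicit Types (c : chart R n M) (p q : M) (V : set M) (T : triple M).

Lemma gac_tripleP T : gac_triple T <->
  [/\ smooth_morphism (tPhi T), smooth_section [set: M] (te1 T),
      smooth_section [set: M] (te2 T)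
    & forall p, fibre_triple (tPhi T p) (te1 T p) (te2 T p)].
Proof.
split=> [[? ? ? iso skew P1 P2 sq]|[? ? ? HT]].
  by split.
by split=> //; move=> p; have [] := HT p.
Qed.

Lemma conj_eframe c p (J : 'M[R]_(n + n + (1 + 1))) : atlas c -> chart_dom c p ->
  invmx (eframe c p) *m J *m eframe c p =
  block_mx (invmx (gframe c p) *m ulsubmx J *m gframe c p)
           (invmx (gframe c p) *m ursubmx J)
           (dlsubmx J *m gframe c p) (drsubmx J).
Proof.
move=> ac cp; have ug := gframe_unit ac cp.
have invE : invmx (eframe c p) = block_mx (invmx (gframe c p)) 0 0 1%:M.
  have K : block_mx (invmx (gframe c p)) 0 0 1%:M *m eframe c p = 1%:M.
    rewrite mulmx_block (mulVmx ug) !mulmx0 !mul0mx mulmx1 !addr0 add0r.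
    by rewrite -scalar_mx_block.
  have [_ ue] := mulmx1_unit K.
  by rewrite -[LHS]mul1mx -K (mulmxK ue).
rewrite invE -{1}(submxK J) !mulmx_block !mul0mx !mulmx0 !mul1mx !mulmx1.
by rewrite !addr0 !add0r.
Qed.

(** Changes of coordinates are isometries, so they transform [cone_endo] by
    transforming its three arguments. *)
Lemma cone_endo_smooth (Phi : M -> 'M[R]_(n + n)) (e e' : M -> 'rV[R]_(n + n)) :
  smooth_morphism Phi -> smooth_section [set: M] e -> smooth_section [set: M] e' ->
  smooth_emorphism (fun p => cone_endo (Phi p) (e p) (e' p)).
Proof.
move=> sP se se' c ac; have oU := open_chart_image (c := c) openT.
pose U := c @` (chart_dom c `&` [set: M]).
have sC : smooth_on U (fun y => - 1%:M *m (gram *m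
    (col_mx (((fun p => e' p *m gframe c p) \o chart_inv c) y)
            (((fun p => e p *m gframe c p) \o chart_inv c) y))^T)).
  apply: (smooth_on_mulmx oU (smooth_on_cst _ _)).
  apply: (smooth_on_mulmx oU (smooth_on_cst _ _)).
  exact: smooth_on_tr oU (smooth_on_col_mx oU (se' c ac) (se c ac)).
have sD := smooth_on_col_mx oU (se c ac) (se' c ac).
apply: (smooth_on_ext oU _ (smooth_on_col_mx oU (smooth_on_row_mx oU (sP c ac) sC)
  (smooth_on_row_mx oU sD (smooth_on_cst _ 0)))).
move=> _ [p [cp _] <-] /=; rewrite (chart_mapK cp) (conj_eframe _ ac cp).
rewrite block_mxKul block_mxKur block_mxKdl block_mxKdr.
rewrite mulNmx mul1mx -!mul_col_mx mulmxN trmx_mul.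
have -> : gram *m ((gframe c p)^T *m (col_mx (e' p) (e p))^T) =
    invmx (gframe c p) *m (gram *m (col_mx (e' p) (e p))^T).
  apply: (canRL (mulKmx (gframe_unit ac cp))).
  by rewrite !mulmxA (gframe_isometry ac cp).
by [].
Qed.

Lemma triple_of_smooth (J : M -> 'M[R]_(n + n + (1 + 1))) : smooth_emorphism J ->
  [/\ smooth_morphism (tPhi (triple_of J)), smooth_section [set: M] (te1 (triple_of J))
    & smooth_section [set: M] (te2 (triple_of J))].
Proof.
move=> sJ; pose G c p := invmx (eframe c p) *m J p *m eframe c p.
pose H c p := block_mx (invmx (gframe c p) *m ulsubmx (J p) *m gframe c p)
           (invmx (gframe c p) *m ursubmx (J p))
           (dlsubmx (J p) *m gframe c p) (drsubmx (J p)).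
have oU c : open (c @` (chart_dom c `&` [set: M])) by exact: open_chart_image openT.
have sH c : atlas c -> smooth_on (c @` (chart_dom c `&` [set: M])) (H c \o chart_inv c).
  move=> ac; apply: (smooth_on_ext (oU c) _ (sJ c ac)) => _ [p [cp _] <-].
  by rewrite /= (chart_mapK cp) (conj_eframe _ ac cp).
have rowE1 c p j : (endo_e1 (J p) *m gframe c p) 0 j =
    H c p (rshift _ (lshift _ 0)) (lshift _ j).
  rewrite /H block_mxEdl endo_e1E -mulmxA.
  rewrite -{1}[dlsubmx (J p) *m _]vsubmxK (mul_row_col 1%:M) mul1mx mul0mx addr0.
  by rewrite mxE.
have rowE2 c p j : (endo_e2 (J p) *m gframe c p) 0 j =
    H c p (rshift _ (rshift _ 0)) (lshift _ j).
  rewrite /H block_mxEdl endo_e2E -mulmxA.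
  rewrite -{1}[dlsubmx (J p) *m _]vsubmxK (mul_row_col 0) mul1mx mul0mx add0r.
  by rewrite mxE.
split=> c ac; apply: (smooth_on_lift (oU c) _ (sH c ac)) => i j.
- exists (lshift _ i), (lshift _ j) => y _.
  by rewrite /= /H block_mxEul -endo_PhiE.
- by exists (rshift _ (lshift _ 0)), (lshift _ j) => y _; rewrite (ord1 i) /= -rowE1.
- by exists (rshift _ (rshift _ 0)), (lshift _ j) => y _; rewrite (ord1 i) /= -rowE2.
Qed.

Lemma Sek0_triple (J : M -> 'M[R]_(n + n + (1 + 1))) : Sek0 J -> gac_triple (triple_of J).
Proof.
case=> sJ J2 skJ vJ; apply/gac_tripleP; have [sP s1 s2] := triple_of_smooth sJ.
split=> // p; exact: cone_endo_triple (J2 p) (skJ p) (vJ p).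
Qed.

Definition cone_of T (p : M) := cone_endo (tPhi T p) (te1 T p) (te2 T p).

Lemma triple_of_cone T : triple_of (cone_of T) = T.
Proof.
case: T => Phi e e'; rewrite /triple_of /cone_of /=.
by congr Triple; apply/funext => p; have [] := endo_cone_endo (Phi p) (e p) (e' p).
Qed.

Lemma cone_of_Sek0 T : gac_triple T -> Sek0 (cone_of T).
Proof.
case/gac_tripleP=> sP s1 s2 HT; split.
- exact: cone_endo_smooth.
- by move=> p; apply: cone_endo_sq (HT p).
- by move=> p; apply: cone_endo_skew (HT p).
- by move=> p; apply: cone_endo_vertical.
Qed.

End ConeFields.

(** * Structures, triples and orbits *)

Section Representation.
Context {R : realType} {n : nat} {M : smooth_manifold R n}.
Implicit Types (c : chart R n M) (p q : M) (V : set M) (T : triple M).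
Implicit Types (E : M -> {vspace 'rV[R]_(n + n)}) (L : M -> {vspace 'rV[R[i]]_(n + n)}).

Lemma gac_fibre E L (e e' : M -> 'rV[R]_(n + n)) p : gac_structure E L ->
  isotropic_pair (e p) (e' p) -> E p = <<[:: e p; e' p]>>%VS ->
  fibre_gac (e p) (e' p) (L p).
Proof.
move=> EL iso Ep; split=> //; first by rewrite -Ep; apply: gac_maximal EL p.
exact: gac_conj EL p.
Qed.

Lemma represented_fibre E L T p : triple_represents T E L ->
  fibre_endo (tPhi T p) (te1 T p) (te2 T p) (L p).
Proof.
case=> gT _ LT; split; [|exact: tPhi_e1|exact: tPhi_e2].
by move=> z Lz; apply/LT.
Qed.

(** [Phi] is determined fibre by fibre, hence globally defined; local smooth
    frames of [L] serve to prove that it is smooth. *)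
Lemma gac_represented E L : gac_structure E L -> exists T, triple_represents T E L.
Proof.
move=> EL; have [e [e' [se se' iso Espan]]] := gac_trivial EL.
have HL p : fibre_gac (e p) (e' p) (L p) by exact: gac_fibre EL (iso p) (Espan p).
pose Phi p := projT1 (cid (fibre_endo_exists (HL p))).
have HPhi p : fibre_endo (Phi p) (e p) (e' p) (L p).
  by rewrite /Phi; case: (cid _).
have sPhi : smooth_morphism Phi.
  have [r smL] := gac_smooth EL.
  apply: smooth_morphism_frame => p; have [V [s [oV Vp ss bs]]] := smL p.
  have sV (f : M -> 'rV[R]_(n + n)) : smooth_section [set: M] f -> smooth_section V f.
    exact: smooth_in_charts_sub.
  have [sB sC] := smooth_frame_mx oV ss (sV _ se) (sV _ se').
  exists (r + r + (1 + 1))%N, V; do 2!eexists; split; last 2 first.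
  - split; [exact: sB|exact: sC].
  - move=> q Vq; split; first exact: (fibre_frame_free (HL q) (bs q Vq)).
    by apply/frame_mx_endo; rewrite (span_basis (bs q Vq)).
  - apply: (fibre_frame_square (HL p)).
    have := basis_free (bs p Vp).
    by rewrite /free (span_basis (bs p Vp)) size_map size_enum_ord => /eqP->.
  - by [].
  - by [].
exists (Triple Phi e e'); split=> //=.
  apply/gac_tripleP; split; [exact: sPhi|exact: se|exact: se'|move=> p].
  exact: (fibre_endo_triple (HL p) (HPhi p)).
by move=> p x; rewrite (fibre_endo_eigen (HL p) (HPhi p)); apply: ieigenP.
Qed.

Lemma isotropic_pair_signature11 (e1 e2 : 'rV[R]_(n + n)) :
  isotropic_pair e1 e2 -> signature11 <<[:: e1; e2]>>.
Proof.
case=> e11 e22 e12; exists (e1 + e2), (e1 - e2).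
have half2 : 2%:R^-1 + 2%:R^-1 = 1 :> R by field.
split.
- apply/vspaceP => x; apply/span2P/span2P => [[k [l ->]]|[k [l ->]]].
    exists (2%:R^-1 * (k + l)), (2%:R^-1 * (k - l)).
    rewrite scalerDr scalerBr addrACA -scalerDl -scalerBl.
    by congr (_ *: _ + _ *: _); field.
  exists (k + l), (k - l).
  by rewrite scalerDr scalerBr addrACA -scalerDl -scalerBl.
- by rewrite !pairingE_lin e11 e22 (pairingC e2) e12 addr0 add0r.
- rewrite !pairingE_lin e11 e22 (pairingC e2) e12 !oppr0 addr0 add0r.
  by rewrite -opprD half2.
- by rewrite !pairingE_lin e11 e22 (pairingC e2) e12 oppr0 addr0 add0r addNr.
Qed.

Lemma isotropic_pair_free (e1 e2 : 'rV[R]_(n + n)) :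
  isotropic_pair e1 e2 -> free [:: e1; e2].
Proof.
case=> e11 _ e12; rewrite free_cons seq1_free span_seq1.
have nz : 2%:R^-1 != 0 :> R by rewrite invr_eq0 two_neq0.
apply/andP; split; last by apply: contraNneq nz => e0; rewrite -e12 e0 pairing0r.
apply: contra nz => /vlineP[k ek]; rewrite -e12.
have [k0|k0] := eqVneq k 0; first by rewrite ek k0 scale0r pairing0l.
by move: e11; rewrite {2}ek pairingZr => /eqP; rewrite mulf_eq0 (negbTE k0).
Qed.

Lemma isotropic_pair_span (e1 e2 f1 f2 : 'rV[R]_(n + n)) :
  isotropic_pair e1 e2 -> isotropic_pair f1 f2 ->
  f1 \in <<[:: e1; e2]>>%VS -> f2 \in <<[:: e1; e2]>>%VS ->
  <<[:: e1; e2]>>%VS = <<[:: f1; f2]>>%VS.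
Proof.
move=> /isotropic_pair_free/eqP de /isotropic_pair_free/eqP df Ef1 Ef2.
apply/esym/eqP; rewrite eqEdim de df leqnn andbT.
by apply/span_subvP => x; rewrite !inE => /orP[] /eqP->.
Qed.

(** Near a point, a frame of the eigenbundle is obtained by projecting onto it
    vectors that are constant in a chart. The rank is constant by the dimension
    count [fibre_corank], so a free family of that size remains a frame. *)
Lemma ieigen_smooth T : gac_triple T -> smooth_csubbundle (fun p => ieigen (tPhi T p)).
Proof.
case/gac_tripleP=> sP s1 s2 HT; exists n.-1 => p.
have HL q := fibre_triple_gac (HT q).
have dimL q : n.-1 = \dim (ieigen (tPhi T q)) by rewrite {1}(fibre_corank (HL q)).
have [b bb] : exists b : 'I_n.-1 -> 'rV[R[i]]_(n + n),
    basis_of (ieigen (tPhi T p)) [seq b j | j <- enum 'I_n.-1].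
  rewrite (dimL p); exists (tnth (vbasis (ieigen (tPhi T p)))).
  by rewrite map_tnth_enum vbasisP.
pose c := chart_at p; have [ac cp] := (chart_at_atlas p, chart_at_dom p).
have oc := @chart_dom_open _ _ _ c.
(* The factor - 1 / 2 compensates the normalization in [ieigen_proj]. *)
pose ext (v : 'rV[R]_(n + n)) q := (- 2%:R^-1 *: v) *m gframe c p *m invmx (gframe c q).
have sext v : smooth_section (chart_dom c) (ext v) by exact: smooth_section_chart_const.
pose u j := ext (map_mx (@complex.Re R) (b j)).
pose w j := ext (map_mx (@complex.Im R) (b j)).
pose Psi := tPhi T.
pose s j q := cx (u j q *m Psi q *m Psi q + - (w j q *m Psi q))
                 (w j q *m Psi q *m Psi q + u j q *m Psi q).
have sE j q : s j q \in ieigen (tPhi T q).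
  pose PsiC := map_mx (real_complex R) (Psi q).
  have -> : s j q = cx (u j q) (w j q) *m PsiC *m PsiC
     + 'i%C *: (cx (u j q) (w j q) *m PsiC).
    by rewrite !cx_mulmx_real cx_scale_i cxD.
  exact: ieigen_proj (HT q) _.
have sp j : s j p = b j.
  have Lb : b j \in ieigen (Psi p).
    by rewrite -(span_basis bb); apply/memv_span/map_f; rewrite mem_enum.
  move: Lb => /ieigenP; rewrite -{1 2}(cx_ReIm (b j)) => /eigen_cx[bP bP'].
  have half (v : 'rV[R]_(n + n)) : 2%:R^-1 *: v + 2%:R^-1 *: v = v.
    have half2 : 2%:R^-1 + 2%:R^-1 = 1 :> R by field.
    by rewrite -scalerDl half2 scale1r.
  rewrite /s /u /w /ext !(mulmxK (gframe_unit ac cp)) -!scalemxAl bP bP' !mulNmx.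
  by rewrite bP bP' !scaleNr !scalerN !opprK !half cx_ReIm.
have ss j : smooth_csection (chart_dom c) (s j).
  have su := smooth_mx_section_endo oc (sext (map_mx (@complex.Re R) (b j))) sP.
  have sw := smooth_mx_section_endo oc (sext (map_mx (@complex.Im R) (b j))) sP.
  split.
    have -> : (fun q => map_mx (@complex.Re R) (s j q)) =
        fun q => u j q *m Psi q *m Psi q + - (w j q *m Psi q).
      by apply/funext => q; rewrite Re_cx.
    exact: smooth_mx_sectionD oc (smooth_mx_section_endo oc su sP) (smooth_mx_sectionN oc sw).
  have -> : (fun q => map_mx (@complex.Im R) (s j q)) =
      fun q => w j q *m Psi q *m Psi q + u j q *m Psi q.
    by apply/funext => q; rewrite Im_cx.
  exact: smooth_mx_sectionD oc (smooth_mx_section_endo oc sw sP) su.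
have sV (f : M -> 'rV[R]_(n + n)) : smooth_section [set: M] f -> smooth_section (chart_dom c) f.
  exact: smooth_in_charts_sub.
have [sB _] := smooth_frame_mx oc ss (sV _ s1) (sV _ s2).
have fp : row_free (frame_mx (s^~ p) (te1 T p) (te2 T p)).
  have -> : s^~ p = b by apply/funext.
  exact: (fibre_frame_free (HL p) bb).
have := near_row_free (fibre_frame_square (HL p) (dimL p)) oc cp sB fp.
rewrite -nbhs_nearE nbhsE => -[V [oV Vp] Vf].
exists (V `&` chart_dom c), s; split; first exact: openI.
- by split.
- move=> j; have [sRe sIm] := ss j.
  by split; [apply: smooth_in_charts_sub sRe|apply: smooth_in_charts_sub sIm] => q [].
- move=> q [Vq _]; rewrite basisEfree size_map size_enum_ord -dimL leqnn andbT.
  rewrite (frame_mx_free (Vf q Vq)) /=; apply/span_subvP => _ /mapP[j _ ->].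
  exact: sE.
Qed.

Lemma gac_structure_triple T : gac_triple T ->
  gac_structure (triple_span T) (fun p => ieigen (tPhi T p)).
Proof.
move=> gT; have [sP s1 s2 HT] := (gac_tripleP T).1 gT.
have HL q := fibre_triple_gac (HT q).
split.
- by exists (te1 T), (te2 T); split=> // p; apply: ft_pair (HT p).
- by move=> p; apply: isotropic_pair_signature11; apply: ft_pair (HT p).
- exact: ieigen_smooth.
- by move=> p; apply: fibre_max (HL p).
- by move=> p z; apply: (fibre_conj (HL p)).
Qed.

(** The isometry of [E] carrying the isotropic frame [e1, e2] to [f1, f2],
    extended by zero on the orthogonal of [E]. *)
Definition frame_change (e1 e2 f1 f2 : 'rV[R]_(n + n)) : 'M[R]_(n + n) :=
  gram *m e2^T *m f1 + gram *m e1^T *m f2.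

Lemma mul_frame_change (e1 e2 f1 f2 : 'rV[R]_(n + n)) x :
  x *m frame_change e1 e2 f1 f2 =
  (2%:R * pairing x e2) *: f1 + (2%:R * pairing x e1) *: f2.
Proof. by rewrite mulmxDr !mulmxA !mul_gram_tr !mul_scalar_mx. Qed.

Lemma frame_change_span (e1 e2 f1 f2 : 'rV[R]_(n + n)) k l : isotropic_pair e1 e2 ->
  (k *: e1 + l *: e2) *m frame_change e1 e2 f1 f2 = k *: f1 + l *: f2.
Proof.
case=> e11 e22 e12.
have half (a : R) : 2%:R * (a * 2%:R^-1) = a.
  by rewrite mulrCA mulfV ?two_neq0 ?mulr1.
rewrite mul_frame_change !pairingE_lin e11 e22 (pairingC e2) e12 !mulr0 addr0 add0r.
by rewrite !half.
Qed.

Lemma frame_change_smooth V (e e' f f' s : M -> 'rV[R]_(n + n)) : open V ->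
  smooth_section V e -> smooth_section V e' -> smooth_section V f ->
  smooth_section V f' -> smooth_section V s ->
  smooth_section V (fun p => s p *m frame_change (e p) (e' p) (f p) (f' p)).
Proof.
move=> oV se se' sf sf' ss c ac; have oU := open_chart_image (c := c) oV.
have sG := smooth_on_mulmx oU (ss c ac) (smooth_on_cst _ gram).
have sk (g : M -> 'rV[R]_(n + n)) (sg : smooth_section V g) :=
  smooth_on_mulmx oU sG (smooth_on_tr oU (sg c ac)).
apply: (smooth_on_ext oU _ (smooth_onD oU (smooth_on_mulmx oU (sk _ se') (sf c ac))
  (smooth_on_mulmx oU (sk _ se) (sf' c ac)))).
move=> _ [p [cp Vp] <-] /=; rewrite (chart_mapK cp) !mul_gram_tr.
rewrite !(pairing_mulmx _ _ (gframe_isometry ac cp)) mul_frame_change mulmxDl -!scalemxAl.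
by rewrite !mul_scalar_mx.
Qed.

Definition frame_change_endo E (e e' f f' : M -> 'rV[R]_(n + n)) : bundle_endo E :=
  fun p => linfun (vsproj (E p) \o
    mulmxr (frame_change (e p) (e' p) (f p) (f' p)) \o vsval).

Lemma frame_change_OE E (e e' f f' : M -> 'rV[R]_(n + n)) :
  smooth_section [set: M] e -> smooth_section [set: M] e' ->
  smooth_section [set: M] f -> smooth_section [set: M] f' ->
  (forall p, isotropic_pair (e p) (e' p)) -> (forall p, isotropic_pair (f p) (f' p)) ->
  (forall p, E p = <<[:: e p; e' p]>>%VS) -> (forall p, E p = <<[:: f p; f' p]>>%VS) ->
  [/\ in_OE (frame_change_endo E e e' f f'),
      endo_app (frame_change_endo E e e' f f') e = f
    & endo_app (frame_change_endo E e e' f f') e' = f'].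
Proof.
move=> se se' sf sf' ie jf Ee Ef.
have inE_ (g g' : M -> 'rV[R]_(n + n)) p k l : E p = <<[:: g p; g' p]>>%VS ->
  k *: g p + l *: g' p \in E p by move=> ->; apply/span2P; exists k, l.
have AE (g g' h h' : M -> 'rV[R]_(n + n)) p k l (u : subvs_of (E p)) :
    isotropic_pair (g p) (g' p) -> E p = <<[:: h p; h' p]>>%VS ->
    vsval u = k *: g p + l *: g' p ->
    vsval (frame_change_endo E g g' h h' p u) = k *: h p + l *: h' p.
  by move=> ig Eh uE; rewrite lfunE /= uE frame_change_span // vsprojK // inE_.
have decE (g g' : M -> 'rV[R]_(n + n)) p (u : subvs_of (E p)) :
    E p = <<[:: g p; g' p]>>%VS -> exists k l, vsval u = k *: g p + l *: g' p.
  by move=> Eg; apply/span2P; rewrite -Eg subvsP.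
have KA (g g' h h' : M -> 'rV[R]_(n + n)) p :
    isotropic_pair (g p) (g' p) -> isotropic_pair (h p) (h' p) ->
    E p = <<[:: g p; g' p]>>%VS -> E p = <<[:: h p; h' p]>>%VS ->
    cancel (frame_change_endo E g g' h h' p) (frame_change_endo E h h' g g' p).
  move=> ig ih Eg Eh u; have [k [l uE]] := decE _ _ p u Eg; apply: val_inj => /=.
  by rewrite uE; apply: (AE _ _ _ _ p _ _ _ ih Eg); apply: (AE _ _ _ _ p _ _ _ ig Eh).
split; first split.
- move=> V s oV sE ss.
  have sV (g : M -> 'rV[R]_(n + n)) : smooth_section [set: M] g -> smooth_section V g.
    exact: smooth_in_charts_sub.
  have sA := frame_change_smooth oV (sV _ se) (sV _ se') (sV _ sf) (sV _ sf') ss.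
  move=> c ac; have oU := open_chart_image (c := c) oV.
  apply: (smooth_on_ext oU _ (sA c ac)) => _ [p [cp Vp] <-] /=.
  rewrite (chart_mapK cp) /endo_app lfunE /= (vsprojK (sE p Vp)) vsprojK //.
  by rewrite mul_frame_change inE_.
- by move=> p; exists (frame_change_endo E f f' e e' p); apply: KA.
- move=> p u v; have [k [l uE]] := decE _ _ p u (Ee p).
  have [k' [l' vE]] := decE _ _ p v (Ee p).
  rewrite (AE _ _ _ _ p _ _ u (ie p) (Ef p) uE) (AE _ _ _ _ p _ _ v (ie p) (Ef p) vE) uE vE.
  have [e11 e22 e12] := ie p; have [f11 f22 f12] := jf p.
  by rewrite !pairingE_lin e11 e22 f11 f22 (pairingC (e' p)) (pairingC (f' p)) e12 f12.
- apply/funext => p; rewrite /endo_app.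
  rewrite (AE e e' f f' p 1 0) ?scale1r ?scale0r ?addr0 //.
  by rewrite vsprojK // -[e p]addr0 -[e p]scale1r -(scale0r (e' p)) inE_.
- apply/funext => p; rewrite /endo_app.
  rewrite (AE e e' f f' p 0 1) ?scale1r ?scale0r ?add0r //.
  by rewrite vsprojK // -[e' p]add0r -[e' p]scale1r -(scale0r (e p)) inE_.
Qed.

(** Two triples representing the same structure have the same [Phi], since its
    values on [L] and [E] are prescribed, and two isotropic frames of the same
    [E], which differ by an isometry of [E]. *)
Lemma same_structure_same_orbit E L J1 J2 : represents J1 E L -> represents J2 E L ->
  gac_structure E L -> same_OE_orbit E J1 J2.
Proof.
move=> r1 r2 EL; have [g1 E1 L1] := r1; have [g2 E2 L2] := r2.
split=> //; set T1 := triple_of J1 in r1 g1 E1 L1 *; set T2 := triple_of J2 in r2 g2 E2 L2 *.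
have [sP1 se1 se1' H1] := (gac_tripleP T1).1 g1.
have [sP2 se2 se2' H2] := (gac_tripleP T2).1 g2.
have [OA A1 A2] := frame_change_OE se1 se1' se2 se2' (fun p => ft_pair (H1 p))
   (fun p => ft_pair (H2 p)) E1 E2.
exists (frame_change_endo E (te1 T1) (te2 T1) (te1 T2) (te2 T2)); split=> //.
have PhiE : tPhi T2 = tPhi T1.
  apply/funext => p.
  have HL := gac_fibre EL (ft_pair (H1 p)) (E1 p).
  apply: (fibre_endo_uniq HL _ (represented_fibre p r1)).
  have [LP e1P e2P] := represented_fibre p r2.
  have EP x : x \in E p -> x *m tPhi T2 p = 0.
    rewrite E2 => /span2P[k [l ->]].
    by rewrite mulmxDl -!scalemxAl e1P e2P !scaler0 addr0.
  split=> //; apply: EP; rewrite E1; apply: memv_span; rewrite !inE eqxx ?orbT //.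
by rewrite /OE_act A1 A2 -PhiE; case: (T2).
Qed.

(** [O(E)] acts on frames of [E] only, so both triples have the same [Phi], and
    its eigenbundle is the required [L]. *)
Lemma same_orbit_same_structure E J1 J2 : Sek0 J1 -> Sek0 J2 -> same_OE_orbit E J1 J2 ->
  exists L, [/\ gac_structure E L, represents J1 E L & represents J2 E L].
Proof.
move=> S1 S2 [E1 [A [OA T2E]]].
have g1 := Sek0_triple S1; have g2 := Sek0_triple S2.
have EE : E = triple_span (triple_of J1) by exact/funext.
exists (fun p => ieigen (tPhi (triple_of J1) p)); split.
- by rewrite EE; apply: gac_structure_triple.
- by split=> // p x; apply: ieigenP.
split=> // [p|p x]; last by rewrite T2E; apply: ieigenP.
have spanE : <<[:: te1 (triple_of J1) p; te2 (triple_of J1) p]>>%VS = E p by rewrite E1.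
rewrite E1; apply: isotropic_pair_span; try exact: te_isotropic.
- by rewrite T2E spanE; apply: subvsP.
- by rewrite T2E spanE; apply: subvsP.
Qed.

End Representation.

Theorem theorem16 (R : realType) (n : nat) (M : smooth_manifold R n)
  (n_odd : odd n) :
  (forall (E : M -> {vspace 'rV[R]_(n + n)})
          (L : M -> {vspace 'rV[R[i]]_(n + n)}),
     gac_structure E L ->
     exists J : M -> 'M[R]_(n + n + (1 + 1)), Sek0 J /\ represents J E L) /\
  (forall (E : M -> {vspace 'rV[R]_(n + n)})
          (J1 J2 : M -> 'M[R]_(n + n + (1 + 1))),
     Sek0 J1 -> Sek0 J2 ->
     (exists L : M -> {vspace 'rV[R[i]]_(n + n)},
        [/\ gac_structure E L, represents J1 E L & represents J2 E L])
     <-> same_OE_orbit E J1 J2).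
Proof.
split=> [E L EL|E J1 J2 S1 S2].
  have [T rT] := gac_represented EL; have [gT _ _] := rT.
  by exists (cone_of T); split; [apply: cone_of_Sek0|rewrite /represents triple_of_cone].
split=> [[L [EL r1 r2]]|]; first exact: same_structure_same_orbit r1 r2 EL.
exact: same_orbit_same_structure.
Qed.
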